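(* Let $\mathcal{M}$ be the space of bounded multiplicative Hankel operators on $\ell^2(\mathbb{N})$ and $\mathcal{M}_0\subset\mathcal{M}$ the subspace of compact ones, both equipped with the operator norm. Then there is a unique isometric isomorphism $U\colon\mathcal{M}_0^{**}\to\mathcal{M}$ such that $U\iota_{\mathcal{M}_0}m=m$ for every $m\in\mathcal{M}_0$, where $\iota_{\mathcal{M}_0}\colon\mathcal{M}_0\to\mathcal{M}_0^{**}$ is the canonical embedding. Furthermore, $\mathcal{M}_0$ is an M-ideal in $\mathcal{M}$.
   Context: For a sequence $\alpha\colon\mathbb{N}\to\mathbb{C}$, the multiplicative Hankel operator $M(\alpha)$ is defined by the form $\langle M(\alpha)a,b\rangle_{\ell^2(\mathbb{N})}=\sum_{n,m=1}^\infty a(n)\overline{b(m)}\alpha(nm)$ for finitely supported $a,b$; it is bounded if this form is bounded by $C\|a\|_{\ell^2}\|b\|_{\ell^2}$, in which case it extends to a bounded operator on $\ell^2(\mathbb{N})$ with matrix $\{\alpha(nm)\}_{n,m\ge1}$. $\mathcal{M}=\{M(\alpha): M(\alpha)\text{ bounded}\}$ and $\mathcal{M}_0=\{M(\alpha): M(\alpha)\text{ compact}\}$ are closed subspaces of the bounded operators, with the operator norm. For a Banach space $Y$, $\iota_Y\colon Y\to Y^{**}$ is $\iota_Y y(y^* )=y^*(y)$. A closed subspace $Z$ of a Banach space $W$ is an M-ideal in $W$ if there is a projection $P$ of $W^*$ onto the annihilator $Z^\perp=\{w^*\in W^*: w^*|_Z=0\}$ such that $\|w^*\|=\|Pw^*\|+\|w^*-Pw^*\|$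 for all $w^*\in W^*$. *)

(* Defs.v *)
From HB Require Import structures.
From mathcomp Require Import all_boot all_order all_algebra.
From mathcomp Require Import boolp classical_sets reals.
From mathcomp Require Import complex.
From mathcomp Require Import Rstruct.
Set Implicit Arguments. Unset Strict Implicit. Unset Printing Implicit Defensive.
Import Order.TTheory GRing.Theory Num.Theory.
Local Open Scope ring_scope.
Local Open Scope classical_set_scope.

Definition R : realType := Rdefinitions.R.
Definition C := R[i].
Definition cabs (z : C) : R := Normc.normc z.

(* Generic Banach-space notions, for spaces of scalar-valued functions *)
(* X -> C (pointwise operations).  A normed space is given by a        *)
(* subspace S of (X -> C) and a norm nrm on it.  To make set-theoretic *)
(* equality coincide with equality of functionals, elements of dual    *)
(* spaces are normalized to vanish outside the space they act on.      *)

Definition lincomb {X : Type} (a : C) (x y : X -> C) : X -> C :=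
  fun t => a * x t + y t.

Definition linear_on {X : Type} (S : set (X -> C)) {Y : Type}
    (f : (X -> C) -> (Y -> C)) : Prop :=
  forall a x y, S x -> S y -> f (lincomb a x y) = lincomb a (f x) (f y).

Definition dual {X : Type} (S : set (X -> C)) (nrm : (X -> C) -> R)
  : set ((X -> C) -> C) :=
  [set f | (forall a x y, S x -> S y -> f (lincomb a x y) = a * f x + f y)
         /\ (exists K : R, forall x, S x -> cabs (f x) <= K * nrm x)
         /\ (forall x, ~ S x -> f x = 0)].

Definition dual_norm {X : Type} (S : set (X -> C)) (nrm : (X -> C) -> R)
  (f : (X -> C) -> C) : R :=
  sup [set r | exists x, S x /\ nrm x <= 1 /\ r = cabs (f x)].

Definition canon {X : Type} (S : set (X -> C)) (nrm : (X -> C) -> R)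
  (x : X -> C) : ((X -> C) -> C) -> C :=
  fun f => if `[< dual S nrm f >] then f x else 0.

Definition annihilator {X : Type} (W Z : set (X -> C)) (nrm : (X -> C) -> R)
  : set ((X -> C) -> C) :=
  [set f | dual W nrm f /\ forall z, Z z -> f z = 0].

(* Z (closed subspace of W, same norm) is an M-ideal in W *)
Definition M_ideal {X : Type} (W Z : set (X -> C)) (nrm : (X -> C) -> R)
  : Prop :=
  exists P : ((X -> C) -> C) -> ((X -> C) -> C),
    linear_on (dual W nrm) P
    /\ (forall f, dual W nrm f -> annihilator W Z nrm (P f))
    /\ (forall f, annihilator W Z nrm f -> P f = f)
    /\ (forall f, dual W nrm f ->
          dual_norm W nrm f
          = dual_norm W nrm (P f) + dual_norm W nrm (lincomb (-1) (P f) f)).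

(* Multiplicative Hankel operators.  Sequences on N = {1,2,...} are    *)
(* functions nat -> C; index 0 is unused.                              *)

Definition finsupp (N : nat) (a : nat -> C) : Prop :=
  a 0%N = 0 /\ forall n, (N < n)%N -> a n = 0.

Definition l2norm (N : nat) (a : nat -> C) : R :=
  Num.sqrt (\sum_(1 <= n < N.+1) cabs (a n) ^+ 2).

(* <M(alpha) a, b> = sum_{n,m} a(n) conj(b(m)) alpha(nm), for a, b
   supported in {1,...,N} *)
Definition hform (N : nat) (alpha a b : nat -> C) : C :=
  \sum_(1 <= n < N.+1) \sum_(1 <= m < N.+1)
     a n * Num.conj (b m) * alpha (n * m)%N.

Definition mh_bounded (alpha : nat -> C) : Prop :=
  exists K : R, forall N a b, finsupp N a -> finsupp N b ->
    cabs (hform N alpha a b) <= K * l2norm N a * l2norm N b.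

Definition mh_norm (alpha : nat -> C) : R :=
  sup [set r | exists N a b, finsupp N a /\ finsupp N b /\
                 l2norm N a <= 1 /\ l2norm N b <= 1 /\
                 r = cabs (hform N alpha a b)].

(* ||M(alpha) x|| for x supported in {1,...,Nx}:
   sup over b in the unit ball of finitely supported sequences *)
Definition mh_apply_norm (alpha : nat -> C) (Nx : nat) (x : nat -> C) : R :=
  sup [set r | exists M b, finsupp M b /\ l2norm M b <= 1 /\
                 r = cabs (hform (maxn Nx M) alpha x b)].

(* compactness of M(alpha): the image of the unit ball (of the dense
   subspace of finitely supported sequences) is relatively compact,
   i.e. every sequence in it has a Cauchy subsequence. *)
Definition mh_compact (alpha : nat -> C) : Prop :=
  forall (x : nat -> nat -> C) (Ns : nat -> nat),
    (forall k, finsupp (Ns k) (x k) /\ l2norm (Ns k) (x k) <= 1) ->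
    exists phi : nat -> nat, (forall k, (phi k < phi k.+1)%N) /\
      forall eps : R, 0 < eps -> exists K, forall k l, (K <= k)%N -> (K <= l)%N ->
        mh_apply_norm alpha (maxn (Ns (phi k)) (Ns (phi l)))
           (lincomb (-1) (x (phi l)) (x (phi k))) <= eps.

(* The space M: sequences alpha (normalized by alpha 0 = 0, so that
   alpha <-> M(alpha) is a bijection) with M(alpha) bounded. *)
Definition MH : set (nat -> C) := [set alpha | alpha 0%N = 0 /\ mh_bounded alpha].

Definition MH0 : set (nat -> C) := [set alpha | MH alpha /\ mh_compact alpha].

Definition MH0_dual := dual MH0 mh_norm.
Definition MH0_dual_norm := dual_norm MH0 mh_norm.
Definition MH0_bidual := dual MH0_dual MH0_dual_norm.
Definition MH0_bidual_norm := dual_norm MH0_dual MH0_dual_norm.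

Definition is_isometric_iso_ext
  (U : (((nat -> C) -> C) -> C) -> (nat -> C)) : Prop :=
  linear_on MH0_bidual U
  /\ (forall Phi, MH0_bidual Phi -> MH (U Phi))
  /\ (forall Phi Psi, MH0_bidual Phi -> MH0_bidual Psi -> U Phi = U Psi -> Phi = Psi)
  /\ (forall alpha, MH alpha -> exists Phi, MH0_bidual Phi /\ U Phi = alpha)
  /\ (forall Phi, MH0_bidual Phi -> mh_norm (U Phi) = MH0_bidual_norm Phi)
  /\ (forall m, MH0 m -> U (canon MH0 mh_norm m) = m).

(* Main.v *)
(** Multiplying a symbol [alpha] by a completely multiplicative [d_k : N -> (0, 1]] replaces
    the operator [A] of [alpha] by [D_k A D_k], with [D_k] the diagonal contraction of [d_k].
    We choose [d_k] with [d_k n -> 0] as [n] grows and [d_k n -> 1] as [k] grows, so that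
    [D_k A D_k] is compact, and a norm limit of finitely supported symbols.

    A sum of [J] forms of norm at most 1, each charging (in rows or in columns) only its own
    block of a sequence of successive blocks, has norm [O(sqrt J)].  Hence a functional [f] on
    the compact operators cannot be bounded below on [alpha - d_k alpha]: the functionals
    [f o D_k] converge to [f] in norm.  So [f] extends to all bounded symbols by
    [ext f alpha = lim f (d_k alpha)], coordinates span a dense subspace of the dual, and
    [Phi |-> (n |-> Phi (alpha |-> alpha n))] is an isometry of the bidual onto [MH] with
    inverse [alpha |-> (f |-> ext f alpha)].

    The L-projection is [f |-> f - ext f].  Writing [B - D B D] as [(1 - D) B (1 - D)] plus two
    cross terms, the same [sqrt J] estimate makes the cross terms negligible after averaging
    over [J] suitable [k]; thus [alpha + beta - avg_k d_k beta] has norm at most [1 + e] for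
    [alpha], [beta] of norm at most 1 with [alpha] compact, and evaluating [f] on it separates the two summands of [f]. *)

Require Import Defs.
From mathcomp Require Import all_boot all_order all_algebra.
From mathcomp Require Import boolp classical_sets reals.
From mathcomp Require Import complex Rstruct ring lra zify.
Set Implicit Arguments. Unset Strict Implicit. Unset Printing Implicit Defensive.
Import Order.TTheory GRing.Theory Num.Theory.
Local Open Scope ring_scope.
Local Open Scope classical_set_scope.
Local Open Scope complex_scope.

Arguments cabs : simpl never.

(** * Complex absolute value *)

Lemma cabs_norm (z : C) : `|z| = (cabs z)%:C.
Proof. by case: z. Qed.

Lemma cabs_ge0 (z : C) : 0 <= cabs z.
Proof. by case: z => a b; exact: sqrtr_ge0. Qed.

Lemma cabs0 : cabs 0 = 0.
Proof. exact: Normc.normc0. Qed.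

Lemma cabs1 : cabs 1 = 1.
Proof. exact: Normc.normc1. Qed.

Lemma cabs_eq0 (z : C) : cabs z = 0 -> z = 0.
Proof. exact: Normc.eq0_normc. Qed.

Lemma cabsM (x y : C) : cabs (x * y) = cabs x * cabs y.
Proof. exact: Normc.normcM. Qed.

Lemma cabsD (x y : C) : cabs (x + y) <= cabs x + cabs y.
Proof. exact: le_normcD. Qed.

Lemma cabsN (x : C) : cabs (- x) = cabs x.
Proof. exact: normcN. Qed.

Lemma cabsB (x y : C) : cabs (x - y) = cabs (y - x).
Proof. by rewrite -cabsN opprB. Qed.

Lemma cabs_real (x : R) : cabs x%:C = `|x|.
Proof. by rewrite /cabs /Normc.normc /= expr0n /= addr0 sqrtr_sqr. Qed.

Lemma cabs_natV n : cabs n%:R^-1 = n%:R^-1.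
Proof.
rewrite /cabs Normc.normcV -(rmorph_nat (real_complex R)) -/(cabs _).
by rewrite cabs_real normr_nat.
Qed.

Lemma cabs_conj (z : C) : cabs (Num.conj z) = cabs z.
Proof. by case: z => a b; rewrite /cabs /Normc.normc /= sqrrN. Qed.

Lemma cabs_Re (z : C) : `|complex.Re z| <= cabs z.
Proof.
case: z => a b /=; rewrite -sqrtr_sqr ler_sqrt ?lerDl ?sqr_ge0//.
by rewrite addr_ge0 ?sqr_ge0.
Qed.

Lemma cabs_Im (z : C) : `|complex.Im z| <= cabs z.
Proof.
case: z => a b /=; rewrite -sqrtr_sqr ler_sqrt ?lerDr ?sqr_ge0//.
by rewrite addr_ge0 ?sqr_ge0.
Qed.

Lemma cabs_le_ReIm (z : C) : cabs z <= `|complex.Re z| + `|complex.Im z|.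
Proof.
have -> : z = (complex.Re z)%:C + 'i%C * (complex.Im z)%:C by case: z => a b; simpc.
rewrite (le_trans (cabsD _ _)) // cabsM !cabs_real.
have -> : cabs 'i%C = 1 by rewrite /cabs /Normc.normc /= expr0n expr1n add0r sqrtr1.
by rewrite mul1r; case: z => a b; simpc.
Qed.

Lemma cabs_sum (I : Type) (r : seq I) (P : pred I) (F : I -> C) :
  cabs (\sum_(i <- r | P i) F i) <= \sum_(i <- r | P i) cabs (F i).
Proof.
elim/big_ind2: _ => [|x1 x2 y1 y2 h1 h2|//]; first by rewrite cabs0.
by rewrite (le_trans (cabsD _ _)) // lerD.
Qed.

Lemma cabs_phase (z : C) : exists2 c : C, cabs c = 1 & c * z = (cabs z)%:C.
Proof.
have [->|nz] := eqVneq z 0; first by exists 1; rewrite ?cabs1 // mulr0 cabs0.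
have cz : cabs z != 0 by apply: contra_neq nz; exact: cabs_eq0.
exists ((cabs z)%:C / z); last by rewrite divfK.
by rewrite cabsM cabs_real ger0_norm ?cabs_ge0 // /cabs Normc.normcV divff.
Qed.

(** * The Hankel form on weighted vectors *)

(** Acts as a diagonal operator when applied to a vector and as a pointwise multiplier when applied
    to a symbol. *)
Definition wt (w : nat -> R) (a : nat -> C) : nat -> C := fun n => (w n)%:C * a n.

(** The form without conjugation, so that it is symmetric in its two vectors. Conjugating a vector
    preserves its norm, so bounds pass between [hform] and [bform]. *)
Definition bform (N : nat) (alpha a b : nat -> C) : C :=
  \sum_(1 <= n < N.+1) \sum_(1 <= m < N.+1) a n * b m * alpha (n * m)%N.

Lemma hform_bform N alpha a b :
  hform N alpha a b = bform N alpha a (fun m => Num.conj (b m)).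
Proof. by []. Qed.

(** The symbol only sees the product [n * m]; this lets every row estimate be reused for columns. *)
Lemma bform_sym N alpha a b : bform N alpha a b = bform N alpha b a.
Proof.
rewrite /bform exchange_big /=; apply: eq_bigr => m _; apply: eq_bigr => n _.
by rewrite [(n * m)%N]mulnC [b m * _]mulrC.
Qed.

Lemma eq_bform N alpha beta a a' b b' :
  (forall n, (1 <= n <= N)%N -> a n = a' n) ->
  (forall n, (1 <= n <= N)%N -> b n = b' n) ->
  (forall n, (1 <= n)%N -> alpha n = beta n) ->
  bform N alpha a b = bform N beta a' b'.
Proof.
move=> ha hb hal; apply: eq_big_nat => n hn; apply: eq_big_nat => m hm.
rewrite ha // hb // hal // muln_gt0; lia.
Qed.

Lemma bform_lincomb N c alpha beta a b :
  bform N (lincomb c alpha beta) a b = c * bform N alpha a b + bform N beta a b.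
Proof.
rewrite /bform mulr_sumr -big_split; apply: eq_bigr => n _ /=.
rewrite mulr_sumr -big_split; apply: eq_bigr => m _ /=.
by rewrite /lincomb; ring.
Qed.

Lemma bform_lincomb_l N alpha c a a' b :
  bform N alpha (lincomb c a a') b = c * bform N alpha a b + bform N alpha a' b.
Proof.
rewrite /bform mulr_sumr -big_split; apply: eq_bigr => n _ /=.
rewrite mulr_sumr -big_split; apply: eq_bigr => m _ /=.
by rewrite /lincomb; ring.
Qed.

Lemma wtD u v w a n : w n = u n + v n -> wt w a n = wt u a n + wt v a n.
Proof. by rewrite /wt => ->; rewrite rmorphD mulrDl. Qed.

Lemma wt_wt u v a : wt u (wt v a) = wt (fun n => u n * v n) a.
Proof. by apply: funext => n; rewrite /wt rmorphM mulrA. Qed.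

Lemma wt1 a : wt (fun=> 1) a = a.
Proof. by apply: funext => n; rewrite /wt mul1r. Qed.

Lemma bform_wtDl N alpha u v w a b :
  (forall n, (1 <= n <= N)%N -> w n = u n + v n) ->
  bform N alpha (wt w a) b = bform N alpha (wt u a) b + bform N alpha (wt v a) b.
Proof.
move=> h; have := bform_lincomb_l N alpha 1 (wt u a) (wt v a) b.
rewrite mul1r => <-; apply: eq_bform => // n hn.
by rewrite /lincomb mul1r; apply: wtD; exact: h.
Qed.

Lemma bform_wtDr N alpha u v w a b :
  (forall n, (1 <= n <= N)%N -> w n = u n + v n) ->
  bform N alpha a (wt w b) = bform N alpha a (wt u b) + bform N alpha a (wt v b).
Proof. by move=> h; rewrite !(bform_sym _ _ a); exact: bform_wtDl. Qed.

Lemma l2norm_ge0 N a : 0 <= l2norm N a.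
Proof. exact: sqrtr_ge0. Qed.

Lemma sqr_l2norm N a : l2norm N a ^+ 2 = \sum_(1 <= n < N.+1) cabs (a n) ^+ 2.
Proof. by rewrite sqr_sqrtr //; apply: sumr_ge0 => n _; rewrite sqr_ge0. Qed.

Lemma ler_l2norm N a x : 0 <= x ->
  \sum_(1 <= n < N.+1) cabs (a n) ^+ 2 <= x ^+ 2 -> l2norm N a <= x.
Proof. by move=> x0 h; rewrite -(@ler_pXn2r _ 2) ?nnegrE ?l2norm_ge0 // sqr_l2norm. Qed.

Lemma eq_l2norm N a b : (forall n, (1 <= n <= N)%N -> cabs (a n) = cabs (b n)) ->
  l2norm N a = l2norm N b.
Proof.
by move=> h; congr (Num.sqrt _); apply: eq_big_nat => n hn; rewrite h.
Qed.

Lemma l2norm_wtS N u v a : 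
  (forall n, (1 <= n <= N)%N -> `|u n| <= `|v n|) -> l2norm N (wt u a) <= l2norm N (wt v a).
Proof.
move=> h; apply: ler_l2norm; rewrite ?l2norm_ge0 // sqr_l2norm !big_nat.
apply: ler_sum => n hn; rewrite !cabsM !cabs_real ler_pXn2r ?nnegrE ?mulr_ge0 ?cabs_ge0 //.
by rewrite ler_wpM2r ?cabs_ge0 // h.
Qed.

Lemma l2norm_wt N c w a : 0 <= c ->
  (forall n, (1 <= n <= N)%N -> `|w n| <= c) -> l2norm N (wt w a) <= c * l2norm N a.
Proof.
move=> c0 h; apply: (le_trans (@l2norm_wtS _ _ (fun=> c) _ _)) => [n /h|].
  by rewrite (ger0_norm c0).
apply: ler_l2norm; rewrite ?mulr_ge0 ?l2norm_ge0 // exprMn sqr_l2norm mulr_sumr.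
by apply: ler_sum => n _; rewrite cabsM cabs_real exprMn ger0_norm.
Qed.

Lemma l2norm_wt_le N w a :
  (forall n, (1 <= n <= N)%N -> `|w n| <= 1) -> l2norm N (wt w a) <= l2norm N a.
Proof. by move=> h; rewrite -[leRHS]mul1r l2norm_wt. Qed.

Lemma sqr_l2norm_wt N w a :
  l2norm N (wt w a) ^+ 2 = \sum_(1 <= n < N.+1) w n ^+ 2 * cabs (a n) ^+ 2.
Proof.
rewrite sqr_l2norm; apply: eq_bigr => n _.
by rewrite cabsM cabs_real exprMn real_normK ?num_real.
Qed.

Lemma sqr_l2norm_wt_le N u v c a :
  (forall n, (1 <= n <= N)%N -> u n ^+ 2 + v n ^+ 2 <= c) ->
  l2norm N (wt u a) ^+ 2 + l2norm N (wt v a) ^+ 2 <= c * l2norm N a ^+ 2.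
Proof.
move=> h; rewrite !sqr_l2norm_wt sqr_l2norm -big_split mulr_sumr !big_nat /=.
by apply: ler_sum => n hn; rewrite -mulrDl ler_wpM2r ?sqr_ge0 ?h.
Qed.

Lemma l2norm_coord N a n : (1 <= n <= N)%N -> cabs (a n) <= l2norm N a.
Proof.
move=> hn; rewrite -(@ler_pXn2r _ 2) ?nnegrE ?l2norm_ge0 ?cabs_ge0 // sqr_l2norm.
rewrite (bigD1_seq n) /= ?mem_index_iota ?iota_uniq //.
by rewrite lerDl sumr_ge0 // => i _; rewrite sqr_ge0.
Qed.

(** * Cauchy-Schwarz inequalities for finite real sums *)

Lemma cauchy_schwarz_nat (u v : nat -> R) (m n : nat) :
  (\sum_(m <= i < n) u i * v i) ^+ 2 <=
  (\sum_(m <= i < n) u i ^+ 2) * (\sum_(m <= i < n) v i ^+ 2).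
Proof.
(* Lagrange's identity: this nonnegative double sum is twice the defect in the inequality. *)
have : 0 <= \sum_(m <= i < n) \sum_(m <= j < n) (u i * v j - u j * v i) ^+ 2.
  by apply: sumr_ge0 => i _; apply: sumr_ge0 => j _; rewrite sqr_ge0.
have -> : \sum_(m <= i < n) \sum_(m <= j < n) (u i * v j - u j * v i) ^+ 2 =
   (\sum_(m <= i < n) u i ^+ 2) * (\sum_(m <= i < n) v i ^+ 2)
   + (\sum_(m <= i < n) v i ^+ 2) * (\sum_(m <= i < n) u i ^+ 2)
   - 2 * ((\sum_(m <= i < n) u i * v i) * (\sum_(m <= i < n) u i * v i)).
  rewrite !mulr_suml mulr_sumr -sumrN -!big_split; apply: eq_bigr => i _ /=.
  rewrite !mulr_sumr -sumrN -!big_split; apply: eq_bigr => j _ /=; ring.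
rewrite expr2; lra.
Qed.

Lemma cauchy_schwarz2 (x y z t a b : R) : 0 <= a -> 0 <= b ->
  x ^+ 2 + y ^+ 2 <= a ^+ 2 -> z ^+ 2 + t ^+ 2 <= b ^+ 2 -> x * z + y * t <= a * b.
Proof.
move=> a0 b0 h1 h2; have [h|h] := lerP (x * z + y * t) 0.
  by rewrite (le_trans h) ?mulr_ge0.
rewrite -(@ler_pXn2r _ 2) ?nnegrE ?mulr_ge0 ?(ltW h) // exprMn.
have h3 : (x ^+ 2 + y ^+ 2) * (z ^+ 2 + t ^+ 2) <= a ^+ 2 * b ^+ 2.
  by apply: ler_pM; rewrite ?addr_ge0 ?sqr_ge0.
apply: le_trans h3; have := sqr_ge0 (x * t - y * z); nra.
Qed.

(** * The operator norm of a symbol *)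

(** The vectors are arbitrary: both sides only see coordinates 1 to [N], and truncation by [cut]
    leads back to the finitely supported vectors of [mh_bounded]. *)
Definition bounded_by (K : R) (alpha : nat -> C) : Prop :=
  forall N a b, cabs (bform N alpha a b) <= K * l2norm N a * l2norm N b.

Definition cut (N : nat) (a : nat -> C) : nat -> C :=
  fun n => if (1 <= n <= N)%N then a n else 0.

Lemma finsupp_cut N a : finsupp N (cut N a).
Proof. by split => [//|n h]; rewrite /cut [(n <= N)%N]leqNgt h andbF. Qed.

Lemma l2norm_cut N a : l2norm N (cut N a) = l2norm N a.
Proof. by apply: eq_l2norm => n hn; rewrite /cut hn. Qed.

Lemma hform_cut N alpha a b :
  hform N alpha (cut N a) (cut N (fun m => Num.conj (b m))) = bform N alpha a b.
Proof.
rewrite hform_bform; apply: eq_bform => // n hn; rewrite /cut hn //.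
exact: conjCK.
Qed.

Lemma l2norm_conj N a : l2norm N (fun m => Num.conj (a m)) = l2norm N a.
Proof. by apply: eq_l2norm => n _; rewrite cabs_conj. Qed.

Lemma mh_boundedP alpha : mh_bounded alpha <-> exists K, bounded_by K alpha.
Proof.
split=> -[K hK]; exists K => N a b.
  have := hK N _ _ (finsupp_cut N a) (finsupp_cut N (fun m => Num.conj (b m))).
  by rewrite hform_cut !l2norm_cut l2norm_conj.
by move=> _ _; rewrite hform_bform -(l2norm_conj N b).
Qed.

Lemma mh_norm_in alpha N a b : l2norm N a <= 1 -> l2norm N b <= 1 ->
  [set r | exists N a b, finsupp N a /\ finsupp N b /\ l2norm N a <= 1 /\
     l2norm N b <= 1 /\ r = cabs (hform N alpha a b)] (cabs (bform N alpha a b)).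
Proof.
move=> ha hb; exists N, (cut N a), (cut N (fun m => Num.conj (b m))).
rewrite hform_cut !l2norm_cut l2norm_conj; do !split=> //; exact: (finsupp_cut _ _).2.
Qed.

Lemma l2norm_scale N (c : R) a : 0 <= c -> l2norm N (wt (fun=> c) a) = c * l2norm N a.
Proof.
move=> c0; rewrite -[RHS]ger0_norm ?mulr_ge0 ?l2norm_ge0 // -sqrtr_sqr exprMn sqr_l2norm.
congr (Num.sqrt _); rewrite mulr_sumr; apply: eq_bigr => n _.
by rewrite cabsM cabs_real exprMn ger0_norm.
Qed.

Lemma bform_scale N alpha (c d : R) a b :
  bform N alpha (wt (fun=> c) a) (wt (fun=> d) b) = (c * d)%:C * bform N alpha a b.
Proof.
rewrite /bform mulr_sumr; apply: eq_bigr => n _; rewrite mulr_sumr; apply: eq_bigr => m _.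
by rewrite /wt rmorphM; ring.
Qed.

Lemma l2norm_zero N : l2norm N (fun=> 0) = 0.
Proof. by rewrite /l2norm big1 ?sqrtr0 // => n _; rewrite cabs0 expr0n. Qed.

Lemma bform_zero N alpha b : bform N alpha (fun=> 0) b = 0.
Proof. by rewrite /bform big1 // => n _; rewrite big1 // => m _; rewrite !mul0r. Qed.

Lemma mh_norm_bound alpha : mh_bounded alpha -> bounded_by (mh_norm alpha) alpha.
Proof.
move=> /mh_boundedP[K hK] N a b.
have ub x y : l2norm N x <= 1 -> l2norm N y <= 1 ->
    cabs (bform N alpha x y) <= mh_norm alpha.
  move=> hx hy; apply: ub_le_sup; last exact: mh_norm_in.
  exists `|K| => _ [M [u [v [_ [_ [hu [hv ->]]]]]]]; rewrite hform_bform.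
  apply: (le_trans (hK _ _ _)); rewrite l2norm_conj -mulrA.
  rewrite (le_trans (ler_norm _)) // normrM ler_piMr // ger0_norm ?mulr_ge0 ?l2norm_ge0 //.
  by rewrite mulr_ile1 ?l2norm_ge0.
(* A vector of norm zero cannot be normalised, but the bound by [K] already makes the form vanish on
   it. *)
have [a0|a0] := eqVneq (l2norm N a) 0.
  by have := hK N a b; rewrite a0 !(mulr0, mul0r).
have [b0|b0] := eqVneq (l2norm N b) 0.
  by have := hK N a b; rewrite b0 !(mulr0, mul0r).
have pa : 0 < l2norm N a by rewrite lt_def a0 l2norm_ge0.
have pb : 0 < l2norm N b by rewrite lt_def b0 l2norm_ge0.
have := ub (wt (fun=> (l2norm N a)^-1) a) (wt (fun=> (l2norm N b)^-1) b).
rewrite !l2norm_scale ?invr_ge0 ?l2norm_ge0 // !mulVf // => /(_ (lexx _) (lexx _)).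
rewrite bform_scale cabsM cabs_real ger0_norm ?mulr_ge0 ?invr_ge0 ?l2norm_ge0 //.
by rewrite -invfM ler_pdivrMl ?mulr_gt0 // mulrC mulrA.
Qed.

Lemma mh_norm_le K alpha : 0 <= K -> bounded_by K alpha -> mh_norm alpha <= K.
Proof.
move=> K0 hK; apply: ge_sup.
  exists (cabs (bform 0 alpha (fun=> 0) (fun=> 0))).
  by apply: mh_norm_in; rewrite l2norm_zero.
move=> _ [N [a [b [_ [_ [ha [hb ->]]]]]]]; rewrite hform_bform.
apply: (le_trans (hK _ _ _)); rewrite l2norm_conj -mulrA ler_piMr //.
by rewrite mulr_ile1 ?l2norm_ge0.
Qed.

Lemma mh_norm_ge0 alpha : mh_bounded alpha -> 0 <= mh_norm alpha.
Proof.
move=> h; have := mh_norm_bound h 1 (fun=> 1) (fun=> 1).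
rewrite /l2norm !big_nat1 cabs1 expr1n sqrtr1 !mulr1; exact: le_trans (cabs_ge0 _).
Qed.

Lemma bounded_by_lincomb K L c alpha beta : bounded_by K alpha -> bounded_by L beta ->
  bounded_by (cabs c * K + L) (lincomb c alpha beta).
Proof.
move=> hK hL N a b; rewrite bform_lincomb (le_trans (cabsD _ _)) // cabsM.
rewrite -mulrA mulrDl -mulrA lerD //; last by rewrite mulrA.
by rewrite ler_wpM2l ?cabs_ge0 // mulrA.
Qed.

Lemma MH_lincomb c alpha beta : MH alpha -> MH beta -> MH (lincomb c alpha beta).
Proof.
move=> [a0 /mh_boundedP[K hK]] [b0 /mh_boundedP[L hL]]; split.
  by rewrite /lincomb a0 b0 mulr0 addr0.
by apply/mh_boundedP; eexists; exact: bounded_by_lincomb hK hL.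
Qed.

Lemma mh_norm_lincomb c alpha beta : MH alpha -> MH beta ->
  mh_norm (lincomb c alpha beta) <= cabs c * mh_norm alpha + mh_norm beta.
Proof.
move=> [_ ha] [_ hb]; apply: mh_norm_le.
  by rewrite addr_ge0 ?mulr_ge0 ?cabs_ge0 ?mh_norm_ge0.
by apply: bounded_by_lincomb; exact: mh_norm_bound.
Qed.

(** The value [alpha n] is the matrix entry at [(n, 1)]. *)
Lemma bounded_by_coord K alpha n : (0 < n)%N -> bounded_by K alpha -> cabs (alpha n) <= K.
Proof.
move=> n0 /(_ n (fun i => (i == n)%:R) (fun i => (i == 1%N)%:R)).
have l2d k : (1 <= k <= n)%N -> l2norm n (fun i => (i == k)%:R) = 1.
  move=> hk; rewrite /l2norm (bigD1_seq k) /= ?mem_index_iota ?iota_uniq //.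
  rewrite eqxx cabs1 expr1n big1 ?addr0 ?sqrtr1 // => i /negPf ->.
  by rewrite cabs0 expr0n.
rewrite !l2d ?n0 ?leqnn // !mulr1 /bform.
rewrite (bigD1_seq n) /= ?mem_index_iota ?iota_uniq ?n0 ?ltnSn //.
rewrite [X in _ + X]big1 ?addr0; last first.
  by move=> i /negPf ->; rewrite big1 // => j _; rewrite !mul0r.
rewrite (bigD1_seq 1%N) /= ?mem_index_iota ?iota_uniq //.
rewrite [X in _ + X]big1 ?addr0; last by move=> i /negPf ->; rewrite mulr0 mul0r.
by rewrite !eqxx !mul1r muln1.
Qed.

Lemma mh_norm_coord alpha n : MH alpha -> cabs (alpha n) <= mh_norm alpha.
Proof.
case: n => [|n] [a0 ha]; first by rewrite a0 cabs0 mh_norm_ge0.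
by apply: bounded_by_coord => //; exact: mh_norm_bound.
Qed.

(** * Compactness as smallness of tails *)

Definition lo (M : nat) : (nat -> C) -> (nat -> C) := wt (fun n => (n <= M)%:R).
Definition hi (M : nat) : (nat -> C) -> (nat -> C) := wt (fun n => (M < n)%:R).

Lemma normr_bool (b : bool) : `|b%:R : R| <= 1.
Proof. by case: b; rewrite ?normr1 ?normr0. Qed.

Lemma l2norm_lo N M a : l2norm N (lo M a) <= l2norm N a.
Proof. by apply: l2norm_wt_le => n _; exact: normr_bool. Qed.

Lemma l2norm_hi N M a : l2norm N (hi M a) <= l2norm N a.
Proof. by apply: l2norm_wt_le => n _; exact: normr_bool. Qed.

Lemma hi_hi M M' a : (M <= M')%N -> hi M (hi M' a) = hi M' a.
Proof.
move=> h; rewrite /hi wt_wt; congr (wt _ a); apply: funext => n.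
by have [h1|h1] := ltnP M' n; rewrite ?mulr0 // (leq_ltn_trans h h1) mulr1.
Qed.

Lemma lo_hiE M n : 1 = (n <= M)%:R + (M < n)%:R :> R.
Proof. by case: leqP => _; rewrite ?addr0 ?add0r. Qed.

Lemma bform_lo_hi_l N alpha M a b :
  bform N alpha a b = bform N alpha (lo M a) b + bform N alpha (hi M a) b.
Proof. by rewrite -[in LHS](wt1 a); apply: bform_wtDl => n _; exact: lo_hiE. Qed.

Lemma bform_lo_hi_r N alpha M a b :
  bform N alpha a b = bform N alpha a (lo M b) + bform N alpha a (hi M b).
Proof. by rewrite -[in LHS](wt1 b); apply: bform_wtDr => n _; exact: lo_hiE. Qed.

Lemma l2norm_mono N N' a : (N <= N')%N -> l2norm N a <= l2norm N' a.
Proof.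
move=> h; apply: ler_l2norm; rewrite ?l2norm_ge0 // sqr_l2norm.
rewrite [leRHS](@big_cat_nat _ _ _ N.+1) //= lerDl sumr_ge0 // => n _.
by rewrite sqr_ge0.
Qed.

Lemma l2norm_widen N N' a : (N <= N')%N -> (forall n, (N < n)%N -> a n = 0) ->
  l2norm N' a = l2norm N a.
Proof.
move=> h a0; rewrite /l2norm (@big_cat_nat _ _ _ N.+1) //= [X in _ + X]big_nat.
by rewrite [X in _ + X]big1 ?addr0 // => n /andP[hn _]; rewrite a0 // cabs0 expr0n.
Qed.

Lemma bform_widen N N' alpha a b : (N <= N')%N -> (forall n, (N < n)%N -> a n = 0) ->
  (forall n, (N < n)%N -> b n = 0) -> bform N' alpha a b = bform N alpha a b.
Proof.
move=> h a0 b0; rewrite /bform (@big_cat_nat _ _ _ N.+1) //= [X in _ + X]big_nat.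
rewrite [X in _ + X]big1 ?addr0; last first.
  by move=> n /andP[hn _]; rewrite big1 // => m _; rewrite a0 // !mul0r.
apply: eq_bigr => n _; rewrite (@big_cat_nat _ _ _ N.+1) //= [X in _ + X]big_nat.
by rewrite [X in _ + X]big1 ?addr0 // => m /andP[hm _]; rewrite b0 // mulr0 mul0r.
Qed.

(** Working form of compactness: the operator is small in norm on vectors supported far out. By
    [bform_sym] the one-sided bound controls both variables. *)
Definition tail_small (alpha : nat -> C) : Prop :=
  forall e : R, 0 < e -> exists M, forall N a b,
    cabs (bform N alpha (hi M a) b) <= e * l2norm N a * l2norm N b.

Definition row (alpha : nat -> C) (m : nat) : nat -> C := fun n => alpha (n * m)%N.

Lemma bform_row N alpha m a b : (1 <= m <= N)%N ->
  bform N alpha a (wt (fun n => (n == m)%:R) b) =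
  b m * \sum_(1 <= n < N.+1) a n * row alpha m n.
Proof.
move=> hm; rewrite /bform mulr_sumr; apply: eq_bigr => n _.
rewrite (bigD1_seq m) /= ?mem_index_iota ?iota_uniq //.
rewrite big1 ?addr0; last by move=> i /negPf h; rewrite /wt h mul0r mulr0 mul0r.
by rewrite /wt eqxx mul1r /row; ring.
Qed.

Lemma sum_cauchy_schwarz N (a r : nat -> C) :
  cabs (\sum_(1 <= n < N.+1) a n * r n) <= l2norm N a * l2norm N r.
Proof.
rewrite (le_trans (cabs_sum _ _ _)) //.
under eq_bigr => n _ do rewrite cabsM.
rewrite -(@ler_pXn2r _ 2) ?nnegrE ?mulr_ge0 ?l2norm_ge0 //; last first.
  by apply: sumr_ge0 => n _; rewrite mulr_ge0 ?cabs_ge0.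
by rewrite exprMn !sqr_l2norm; exact: cauchy_schwarz_nat.
Qed.

(** Testing the form on the conjugated row against the [m]-th basis vector gives the squared norm of
    the row. The cutoff is first enlarged to [maxn N m] so that this basis vector is in range. *)
Lemma row_bounded K alpha m N : (0 < m)%N -> bounded_by K alpha ->
  l2norm N (row alpha m) <= `|K|.
Proof.
move=> m0 hK; apply: (le_trans (l2norm_mono (row alpha m) (leq_maxl N m))).
set M := maxn N m; set r := row alpha m.
have [-> //|r0] := eqVneq (l2norm M r) 0.
have rp : 0 < l2norm M r by rewrite lt_def r0 l2norm_ge0.
have hm : (1 <= m <= M)%N by rewrite m0 leq_maxr.
have := hK M (fun n => Num.conj (r n)) (wt (fun n => (n == m)%:R) (fun=> 1)).
have -> : bform M alpha (fun n => Num.conj (r n)) (wt (fun n => (n == m)%:R) (fun=> 1)) =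
    (l2norm M r ^+ 2)%:C.
  rewrite bform_row // mul1r sqr_l2norm rmorph_sum; apply: eq_bigr => n _.
  by rewrite mulrC -normCK cabs_norm rmorphXn.
have -> : l2norm M (wt (fun n => (n == m)%:R) (fun=> 1)) = 1.
  rewrite /l2norm (bigD1_seq m) /= ?mem_index_iota ?iota_uniq //.
  rewrite /wt cabsM cabs_real eqxx normr1 mul1r cabs1 expr1n big1 ?addr0 ?sqrtr1 // => i /negPf ->.
  by rewrite mul0r cabs0 expr0n.
rewrite mulr1 l2norm_conj cabs_real ger0_norm ?sqr_ge0 // expr2 ler_pM2r // => h.
exact: le_trans (ler_norm _).
Qed.

(** A row is square summable. Choosing [M] so that the squared norm up to [M] is within [e ^ 2] of
    its supremum leaves at most [e ^ 2] beyond [M]. *)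
Lemma row_tail1 alpha m (e : R) : mh_bounded alpha -> (0 < m)%N -> 0 < e ->
  exists M, forall N, l2norm N (hi M (row alpha m)) <= e.
Proof.
move=> /mh_boundedP[K hK] m0 e0; set r := row alpha m.
pose E := [set x : R | exists N, x = l2norm N r ^+ 2].
have hE : has_sup E.
  split; first by exists (l2norm 0 r ^+ 2); exists 0%N.
  exists (`|K| ^+ 2) => _ [N ->].
  by rewrite ler_pXn2r ?nnegrE ?l2norm_ge0 // row_bounded.
have [_ [M ->] hM] := sup_adherent (exprn_gt0 2 e0) hE.
exists M => N; apply: (le_trans (l2norm_mono _ (leq_maxl N M))).
set N' := maxn N M.
have h1 : l2norm N' (lo M r) ^+ 2 + l2norm N' (hi M r) ^+ 2 <= 1 * l2norm N' r ^+ 2.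
  by apply: sqr_l2norm_wt_le => n _; case: leqP; rewrite ?expr1n ?expr0n ?addr0 ?add0r.
have h2 : l2norm M r <= l2norm N' (lo M r).
  rewrite (@eq_l2norm M r (lo M r)) ?l2norm_mono ?leq_maxr // => n /andP[_ hn].
  by rewrite /lo /wt hn mul1r.
have h3 : l2norm M r ^+ 2 <= l2norm N' (lo M r) ^+ 2.
  by rewrite ler_pXn2r ?nnegrE ?l2norm_ge0.
have h4 : l2norm N' r ^+ 2 <= sup E by apply: ub_le_sup; [exact: hE.2|exists N'].
rewrite -(@ler_pXn2r _ 2) ?nnegrE ?l2norm_ge0 ?(ltW e0) //; lra.
Qed.

(** Against finitely many coordinates only finitely many rows matter, and each has a small tail. The
    induction on [L] adds one row at a time and halves the tolerance. *)
Lemma row_tail alpha L (e : R) : mh_bounded alpha -> 0 < e ->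
  exists M, forall N a b,
    cabs (bform N alpha (hi M a) (lo L b)) <= e * l2norm N a * l2norm N b.
Proof.
move=> hal; elim: L e => [|L IH] e e0.
  exists 0%N => N a b; rewrite bform_sym (@eq_bform _ _ alpha _ (fun=> 0) _ (hi 0 a)) //.
    by rewrite bform_zero cabs0 !mulr_ge0 ?l2norm_ge0 ?(ltW e0).
  by move=> n /andP[hn _]; rewrite /lo /wt leqNgt hn mul0r.
have e2 : 0 < e / 2 by rewrite divr_gt0.
have [M1 h1] := IH _ e2; have [M2 h2] := row_tail1 hal (ltn0Sn L) e2.
exists (maxn M1 M2) => N a b.
rewrite (@bform_wtDr _ _ (fun n => (n <= L)%:R) (fun n => (n == L.+1)%:R)); last first.
  move=> n _; rewrite [(n <= L.+1)%N]leq_eqVlt ltnS.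
  by case: eqP => [->|_]; rewrite ?ltnn ?add0r ?addr0.
rewrite (le_trans (cabsD _ _)) // [e]splitr !mulrDl lerD //.
  rewrite -(hi_hi _ (leq_maxl M1 M2)) (le_trans (h1 _ _ _)) //.
  by rewrite ler_wpM2r ?l2norm_ge0 // ler_wpM2l ?(ltW e2) ?l2norm_hi.
have [hN|hN] := leqP L.+1 N; last first.
  rewrite bform_sym (@eq_bform _ _ alpha _ (fun=> 0) _ (hi (maxn M1 M2) a)) //.
    by rewrite bform_zero cabs0 !mulr_ge0 ?l2norm_ge0 ?invr_ge0 ?(ltW e0).
  move=> n /andP[_ hn]; rewrite /wt.
  by case: eqP => [E|_]; rewrite ?mul0r //; move: hN; rewrite -E ltnNge hn.
rewrite bform_row ?hN // cabsM mulrC ler_pM ?cabs_ge0 //; last first.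
  by apply: l2norm_coord; rewrite hN.
rewrite -(hi_hi _ (leq_maxr M1 M2)); set a' := hi (maxn M1 M2) a.
rewrite (eq_bigr (fun n => a' n * hi M2 (row alpha L.+1) n)); last first.
  by move=> n _; rewrite /hi /wt; ring.
rewrite (le_trans (sum_cauchy_schwarz _ _ _)) //.
by rewrite [leLHS]mulrC ler_pM ?l2norm_ge0 ?l2norm_hi ?h2.
Qed.

(** * Diagonal extraction from bounded complex sequences *)

Definition infinite_nat (S : set nat) : Prop := forall K, exists2 i, (K <= i)%N & S i.

(** Pigeonhole, one window of width [d] at a time: either infinitely many indices have their value
    above the lowest window, or all late indices of [S] have it inside. *)
Lemma infinite_window (u : nat -> R) (d : R) j (a : R) (S : set nat) : infinite_nat S ->
  (forall i, S i -> a <= u i <= a + j.+1%:R * d) ->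
  exists T : set nat, [/\ infinite_nat T, T `<=` S &
    forall i k, T i -> T k -> `|u i - u k| <= d].
Proof.
elim: j a S => [|j IH] a S iS hS.
  exists S; split => // i k /hS hi /hS hk; rewrite ler_norml; lra.
have [iT|nT] := pselect (infinite_nat [set i | S i /\ a + d <= u i]).
  have [|T [h1 h2 h3]] := IH (a + d) _ iT.
    by move=> i [/hS/andP[_ h1] h2]; rewrite h2 (le_trans h1) // -[j.+2%:R]natr1; lra.
  by exists T; split => // i /h2[].
move/existsNP: nT => [K hK]; exists [set i | S i /\ (K <= i)%N]; split.
- move=> L; have [i hi Si] := iS (maxn K L).
  by exists i; [|split]; rewrite // (leq_trans _ hi) ?leq_maxl ?leq_maxr.
- by move=> i [].
have lt i : S i -> (K <= i)%N -> a <= u i < a + d.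
  move=> Si Ki; have /andP[-> _] := hS _ Si; rewrite ltNge; apply/negP => h.
  by apply: hK; exists i.
by move=> i k [Si Ki] [Sk Kk]; have := lt i Si Ki; have := lt k Sk Kk; rewrite ler_norml; lra.
Qed.

Lemma infinite_close (u : nat -> R) (d : R) (S : set nat) : infinite_nat S -> 0 < d ->
  (forall i, `|u i| <= 1) ->
  exists T : set nat, [/\ infinite_nat T, T `<=` S &
    forall i k, T i -> T k -> `|u i - u k| <= d].
Proof.
move=> iS d0 hu; pose j := Num.bound (2 / d).
have hj : 2 / d < j.+1%:R.
  by rewrite (lt_trans (archi_boundP _)) ?divr_ge0 ?(ltW d0) // ltr_nat.
apply: (@infinite_window u d j (-1)) => // i _; rewrite ltr_pdivrMr // in hj.
have := hu i; rewrite ler_norml => /andP[-> h] /=; lra.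
Qed.

Lemma infinite_close_coords (x : nat -> nat -> C) (m : nat) (d : R) (S : set nat) :
  infinite_nat S -> 0 < d -> (forall i n, cabs (x i n) <= 1) ->
  exists T : set nat, [/\ infinite_nat T, T `<=` S &
    forall i k, T i -> T k -> forall n, (n < m)%N -> cabs (x i n - x k n) <= d].
Proof.
move=> iS d0 hx; elim: m => [|m [T [h1 h2 h3]]]; first by exists S; split.
have d2 : 0 < d / 2 by rewrite divr_gt0.
have [|T1 [h4 h5 h6]] := infinite_close (u := fun i => complex.Re (x i m)) h1 d2.
  by move=> i; exact: le_trans (cabs_Re _) _.
have [|T2 [h7 h8 h9]] := infinite_close (u := fun i => complex.Im (x i m)) h4 d2.
  by move=> i; exact: le_trans (cabs_Im _) _.
exists T2; split => // [i /h8/h5/h2 //|i k Ti Tk n].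
rewrite ltnS leq_eqVlt => /orP[/eqP->|nm]; last by apply: h3 => //; apply: h5; exact: h8.
rewrite (le_trans (cabs_le_ReIm _)) // [d]splitr lerD //.
  by have := h6 _ _ (h8 _ Ti) (h8 _ Tk); case: (x i m); case: (x k m).
by have := h9 _ _ Ti Tk; case: (x i m); case: (x k m).
Qed.

Lemma diagonal_extraction (x : nat -> nat -> C) : (forall i n, cabs (x i n) <= 1) ->
  exists phi : nat -> nat, (forall k, (phi k < phi k.+1)%N) /\
    forall m (e : R), 0 < e -> exists K, forall k l, (K <= k)%N -> (K <= l)%N ->
      forall n, (n < m)%N -> cabs (x (phi k) n - x (phi l) n) <= e.
Proof.
move=> hx.
(* Stated with an implication inside, so that [choice] gives a total refinement map [F]; [set0] is a
   placeholder when [p.2] is bounded. *)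
have step (p : nat * set nat) : exists T : set nat, infinite_nat p.2 ->
    [/\ infinite_nat T, T `<=` p.2 & forall i k, T i -> T k ->
      forall n, (n < p.1)%N -> cabs (x i n - x k n) <= p.1.+1%:R^-1].
  have [iS|nS] := pselect (infinite_nat p.2); last by exists set0 => /nS.
  have d0 : 0 < p.1.+1%:R^-1 :> R by rewrite invr_gt0.
  by have [T hT] := infinite_close_coords p.1 iS d0 hx; exists T.
have [F hF] := choice step.
(* Indices in [S k.+1] have their first [k] coordinates within [1 / (k + 1)] of each other. *)
pose S := fix S k := if k is k'.+1 then F (k', S k') else setT.
have iS k : infinite_nat (S k).
  by elim: k => [K|k IH]; [exists K|case: (hF (k, S k) IH)].
have SS k l : (k <= l)%N -> S l `<=` S k.
  elim: l => [|l IH]; first by rewrite leqn0 => /eqP->.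
  rewrite leq_eqVlt => /orP[/eqP->//|kl]; apply: subset_trans (IH kl).
  by case: (hF (l, S l) (iS l)).
have pk (p : nat * nat) : exists i, (p.2 <= i)%N /\ S p.1 i.
  by have [i h1 h2] := iS p.1 p.2; exists i.
have [g hg] := choice pk.
(* [phi k] is taken in [S k] beyond the previous index, so by nestedness every tail of [phi] lies in
   the corresponding [S k]. *)
pose phi := fix phi k := if k is k'.+1 then g (k, (phi k').+1) else g (0, 0)%N.
exists phi; split => [k|m e e0]; first exact: (hg (k.+1, (phi k).+1)).1.
have Sphi k : S k (phi k) by case: k => [//|k]; exact: (hg (k.+1, (phi k).+1)).2.
pose K := maxn m (Num.bound e^-1).
have hK : K.+1%:R^-1 <= e.
  rewrite -[leRHS]invrK lef_pV2 ?posrE ?invr_gt0 //.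
  rewrite (le_trans (ltW (archi_boundP _))) ?invr_ge0 ?(ltW e0) // ler_nat.
  by rewrite (leq_trans (leq_maxr m _)).
exists K.+1 => k l hk hl n hn; apply: le_trans hK.
have [_ _ h] := hF (K, S K) (iS K).
by apply: h; [exact: (SS _ _ hk)|exact: (SS _ _ hl)|rewrite /= (leq_trans hn) ?leq_maxl].
Qed.

(** * Compactness is equivalent to smallness of tails *)

Lemma phi_ge (phi : nat -> nat) k : (forall k, (phi k < phi k.+1)%N) -> (k <= phi k)%N.
Proof. by move=> h; elim: k => // k IH; exact: leq_ltn_trans (h k). Qed.

Lemma finsupp_lincomb N N' c a b : finsupp N a -> finsupp N' b ->
  finsupp (maxn N' N) (lincomb c a b).
Proof.
move=> [a0 ha] [b0 hb]; split=> [|n]; first by rewrite /lincomb a0 b0 mulr0 addr0.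
by rewrite gtn_max => /andP[h1 h2]; rewrite /lincomb ha ?hb // mulr0 addr0.
Qed.

Lemma mh_apply_norm_ge alpha Nx x N b : mh_bounded alpha -> finsupp Nx x ->
  (Nx <= N)%N -> l2norm N b <= 1 -> cabs (bform N alpha x b) <= mh_apply_norm alpha Nx x.
Proof.
move=> /mh_boundedP[K hK] [_ hx] hN hb; apply: ub_le_sup; last first.
  exists N, (cut N (fun m => Num.conj (b m))); split; first exact: finsupp_cut.
  rewrite l2norm_cut l2norm_conj; split => //; rewrite (maxn_idPr hN) hform_bform.
  congr cabs; apply: eq_bform => // n hn; rewrite /cut hn; exact/esym/conjCK.
exists (`|K| * l2norm Nx x) => _ [M [c [[_ hc] [c1 ->]]]]; rewrite hform_bform.
rewrite (le_trans (hK _ _ _)) // l2norm_conj (l2norm_widen (leq_maxl _ _) hx).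
rewrite (l2norm_widen (leq_maxr _ _) hc).
rewrite (@le_trans _ _ (`|K| * l2norm Nx x * l2norm M c)) //.
  by rewrite !ler_wpM2r ?l2norm_ge0 // ler_norm.
by rewrite ler_piMr // mulr_ge0 ?l2norm_ge0.
Qed.

(** Otherwise there are unit vectors supported beyond every [M] whose images pair to more than [e]
    with some unit vector. Fix one member of a subsequence with Cauchy images and its test vector:
    by [row_tail], a late member pairs to at most [e / 4] with that test vector, so the two images
    differ by more than [e / 2]. *)
Lemma compact_tail_small alpha : mh_bounded alpha -> mh_compact alpha -> tail_small alpha.
Proof.
move=> hal hc e e0; apply: contrapT => /forallNP hn.
have hK := mh_norm_bound hal.
have ex M : exists p : nat * (nat -> C) * (nat -> C),
   [/\ finsupp p.1.1 p.1.2, finsupp p.1.1 p.2, l2norm p.1.1 p.1.2 <= 1,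
       l2norm p.1.1 p.2 <= 1 & hi M p.1.2 = p.1.2 /\ e < cabs (bform p.1.1 alpha p.1.2 p.2)].
  have /existsNP[N /existsNP[a /existsNP[b /negP]]] := hn M; rewrite -ltNge => hlt.
  have [a0|a0] := eqVneq (l2norm N a) 0.
    have := hK N (hi M a) b; have -> : l2norm N (hi M a) = 0.
      by apply/le_anti; rewrite l2norm_ge0 -[X in _ <= X]a0 l2norm_hi.
    by move: hlt; rewrite a0 !(mulr0, mul0r) => /lt_le_trans h /h; rewrite ltxx.
  have [b0|b0] := eqVneq (l2norm N b) 0.
    have := hK N (hi M a) b.
    by move: hlt; rewrite b0 !(mulr0, mul0r) => /lt_le_trans h /h; rewrite ltxx.
  have pa : 0 < l2norm N a by rewrite lt_def a0 l2norm_ge0.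
  have pb : 0 < l2norm N b by rewrite lt_def b0 l2norm_ge0.
  exists (N, hi M (cut N (wt (fun=> (l2norm N a)^-1) a)), cut N (wt (fun=> (l2norm N b)^-1) b)).
  split => /=.
  - split => [|n h]; rewrite /hi /wt; last by rewrite (finsupp_cut _ _).2 // mulr0.
    by rewrite (finsupp_cut _ _).1 mulr0.
  - exact: finsupp_cut.
  - by rewrite (le_trans (l2norm_hi _ _ _)) // l2norm_cut l2norm_scale ?invr_ge0 ?(ltW pa) // mulVf.
  - by rewrite l2norm_cut l2norm_scale ?invr_ge0 ?(ltW pb) // mulVf.
  split; first by rewrite hi_hi.
  rewrite (@eq_bform _ _ alpha _ (wt (fun=> (l2norm N a)^-1) (hi M a)) _
     (wt (fun=> (l2norm N b)^-1) b)) //.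
  - rewrite bform_scale cabsM cabs_real -invfM ger0_norm ?invr_ge0 ?mulr_ge0 ?l2norm_ge0 //.
    by rewrite ltr_pdivlMl ?mulr_gt0 // mulrC mulrA.
  - by move=> n h; rewrite /hi /wt /cut h; ring.
  - by move=> n h; rewrite /cut h.
have [p hp] := choice ex.
have [phi [phiI hphi]] := hc (fun k => (p k).1.2) (fun k => (p k).1.1)
  (fun k => let: And5 h1 _ h3 _ _ := hp k in conj h1 h3).
have e2 : 0 < e / 2 by rewrite divr_gt0.
have e4 : 0 < e / 4 by rewrite divr_gt0.
have [K hKK] := hphi _ e2; set k := phi K.
have [f1 f2 n1 n2 [_ big]] := hp k.
have [M hM] := row_tail (p k).1.1 hal e4.
(* Past the Cauchy threshold [K], and at least [M] because [phi] is strictly increasing. *)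
pose l := phi (maxn K M).
have [g1 _ m1 _ [hl _]] := hp l.
have Ml : (M <= l)%N by rewrite (leq_trans _ (phi_ge _ phiI)) ?leq_maxr.
have := hKK K (maxn K M) (leqnn _) (leq_maxl _ _); rewrite -/k -/l.
set N := maxn _ _; set D := lincomb _ _ _.
have zN : l2norm N (p k).2 <= 1 by rewrite (l2norm_widen (leq_maxl _ _)) //; exact: f2.2.
have h1 := mh_apply_norm_ge hal (finsupp_lincomb (-1) g1 f1) (leqnn _) zN.
move=> /(le_trans h1); rewrite -/N -/D bform_lincomb_l.
rewrite [X in _ + X](bform_widen _ (leq_maxl _ _) f1.2 f2.2).
have h2 : cabs (bform N alpha (p l).1.2 (p k).2) <= e / 4.
  have -> : bform N alpha (p l).1.2 (p k).2 = bform N alpha (hi M (p l).1.2) (lo (p k).1.1 (p k).2).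
    rewrite -{2}hl hi_hi // hl; apply: eq_bform => // n _; rewrite /lo /wt.
    by case: leqP => hn'; rewrite ?mul1r // mul0r f2.2.
  rewrite (le_trans (hM _ _ _)) // -mulrA ler_piMr ?(ltW e4) //.
  rewrite mulr_ile1 ?l2norm_ge0 // (l2norm_widen (leq_maxr _ _)) //; exact: g1.2.
set z := bform N _ _ _ in h2 *; set t := bform _ _ _ _ in big *.
rewrite mulN1r => h3; have := cabsD (- z + t) z; rewrite addrAC addNr add0r; lra.
Qed.

Lemma sum_indicator N M : \sum_(1 <= n < N.+1) ((n <= M)%:R : R) <= M%:R.
Proof.
rewrite -natr_sum ler_nat; have -> : (\sum_(1 <= n < N.+1) (n <= M) = minn N M)%N.
  elim: N => [|N IH]; first by rewrite big_geq // min0n.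
  by rewrite big_nat_recr //= IH; case: leqP; lia.
exact: geq_minr.
Qed.

Lemma l2norm_lo_coords N M a (d : R) : 0 <= d -> (forall n, (n <= M)%N -> cabs (a n) <= d) ->
  l2norm N (lo M a) <= M%:R * d.
Proof.
move=> d0 h; apply: ler_l2norm; first by rewrite mulr_ge0.
rewrite (@le_trans _ _ (\sum_(1 <= n < N.+1) (n <= M)%:R * d ^+ 2)) //.
  apply: ler_sum => n _; rewrite /lo /wt cabsM cabs_real exprMn.
  case: leqP => hn; rewrite ?normr0 ?normr1 ?expr0n ?mul0r // expr1n !mul1r.
  by rewrite ler_pXn2r ?nnegrE ?cabs_ge0 ?h.
rewrite -mulr_suml exprMn ler_wpM2r ?sqr_ge0 // (le_trans (sum_indicator _ _)) //.
by rewrite -natrX ler_nat; nia.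
Qed.

(** Extract a subsequence that is Cauchy in every coordinate. Differences then have small heads, and
    the tails contribute little by hypothesis. *)
Lemma tail_small_compact alpha : mh_bounded alpha -> tail_small alpha -> mh_compact alpha.
Proof.
move=> hal ht x Ns hx; have hK := mh_norm_bound hal; have K0 := mh_norm_ge0 hal.
have x1 i n : cabs (x i n) <= 1.
  have [[x0 xN] xl] := hx i; case: n => [|n]; first by rewrite x0 cabs0.
  have [hn|hn] := leqP n.+1 (Ns i); last by rewrite xN // cabs0.
  by apply: le_trans xl; exact: l2norm_coord.
have [phi [phiI hphi]] := diagonal_extraction x1.
exists phi; split => // e e0.
have e4 : 0 < e / 4 by rewrite divr_gt0.
have [M hM] := ht _ e4.
(* The head of the difference has norm at most [M%:R * d], so its image contributes at most [e / 2];
   adding 1 keeps both denominators positive. *)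
pose d := e / 2 / ((mh_norm alpha + 1) * M.+1%:R).
have p1 : 0 < mh_norm alpha + 1 by rewrite ltr_wpDl.
have d0 : 0 < d by rewrite !divr_gt0 // mulr_gt0.
have [K hKK] := hphi M.+1 d d0; exists K => k l hk hl.
apply: ge_sup.
  eexists; exists 0%N, (fun=> 0); split; first by [].
  by rewrite l2norm_zero; split; [exact: ler01|reflexivity].
move=> _ [L [b [[_ fb] [b1 ->]]]]; rewrite hform_bform.
set N := maxn _ L; set b' := fun m => _; set D := lincomb _ _ _.
have b'1 : l2norm N b' <= 1 by rewrite l2norm_conj (l2norm_widen (leq_maxr _ _)).
have xN i : (i = k \/ i = l) -> l2norm N (x (phi i)) <= 1.
  move=> ikl; have [[_ xN] xl] := hx (phi i).
  by rewrite (l2norm_widen (N := Ns (phi i))) //; rewrite /N; case: ikl => ->; lia.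
have small i : (i = k \/ i = l) -> cabs (bform N alpha (hi M (x (phi i))) b') <= e / 4.
  move=> ikl; rewrite (le_trans (hM _ _ _)) // -mulrA ler_piMr ?(ltW e4) //.
  by rewrite mulr_ile1 ?l2norm_ge0 // xN.
rewrite (bform_lo_hi_l _ _ M).
have -> : hi M D = lincomb (-1) (hi M (x (phi l))) (hi M (x (phi k))).
  by apply: funext => n; rewrite /D /lincomb /hi /wt; ring.
rewrite bform_lincomb_l mulN1r.
have h1 := small k (or_introl erefl); have h2 := small l (or_intror erefl).
have h3 : cabs (bform N alpha (lo M D) b') <= e / 2.
  rewrite (le_trans (hK _ _ _)) // (@le_trans _ _ (mh_norm alpha * l2norm N (lo M D))) //.
    by rewrite ler_piMr // mulr_ge0 ?l2norm_ge0.
  have hD : l2norm N (lo M D) <= M%:R * d.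
    apply: l2norm_lo_coords => [|n hn]; first exact: ltW.
    by rewrite /D /lincomb mulN1r addrC hKK.
  rewrite (@le_trans _ _ ((mh_norm alpha + 1) * (M.+1%:R * d))) //.
    apply: ler_pM => //; rewrite ?l2norm_ge0 ?lerDl // (le_trans hD) //.
    by rewrite ler_wpM2r ?(ltW d0) // ler_nat.
  by rewrite mulrA /d mulrC divfK // mulf_neq0 ?gt_eqF.
rewrite (le_trans (cabsD _ _)) //.
have := cabsD (- bform N alpha (hi M (x (phi l))) b') (bform N alpha (hi M (x (phi k))) b').
rewrite cabsN; lra.
Qed.

Lemma MH0P alpha : MH0 alpha <-> MH alpha /\ tail_small alpha.
Proof.
split=> -[h1 h2]; split => //; first exact: compact_tail_small h1.2 h2.
exact: tail_small_compact h1.2 h2.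
Qed.

(** * Completely multiplicative dampings *)

(* Any completely additive function with finite level sets would do. *)
Definition plevel (n : nat) : nat := (\sum_(0 <= p < n.+1) p * logn p n)%N.

Lemma plevel_widen n B : (0 < n)%N -> (n <= B)%N ->
  plevel n = (\sum_(0 <= p < B.+1) p * logn p n)%N.
Proof.
move=> n0 h; rewrite /plevel [RHS](@big_cat_nat _ _ _ n.+1) //= [X in (_ + X)%N]big_nat.
by rewrite [X in (_ + X)%N]big1 ?addn0 // => p /andP[hp _]; rewrite ltn_log0 ?muln0.
Qed.

Lemma plevelM m n : (0 < m)%N -> (0 < n)%N -> plevel (m * n) = (plevel m + plevel n)%N.
Proof.
move=> m0 n0; rewrite (plevel_widen m0 (leq_pmulr _ n0)) (plevel_widen n0 (leq_pmull _ m0)).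
by rewrite -big_split; apply: eq_bigr => p _; rewrite lognM // mulnDr.
Qed.

(** Prime by prime, [p ^ e <= 2 ^ (p * e)]. This makes the level sets of [plevel] finite. *)
Lemma leq_plevel n : (0 < n)%N -> (n <= 2 ^ plevel n)%N.
Proof.
move=> n0; rewrite -{1}(partnT n0) /partn /plevel expn_sum; apply: leq_prod => p _.
rewrite expnM; case: (logn p n) => [|e]; first by rewrite !expn0.
by rewrite leq_exp2r // ltnW // ltn_expl.
Qed.

(** An explicit sequence in the open unit interval increasing to 1, with
    [1 - qr k = 1 / (k + 2)]. *)
Definition qr (k : nat) : R := k.+1%:R / k.+2%:R.

Lemma qr_gt0 k : 0 < qr k.
Proof. by rewrite divr_gt0. Qed.

Lemma qr_lt1 k : qr k < 1.
Proof. by rewrite ltr_pdivrMr // mul1r ltr_nat. Qed.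

Lemma subr_qr k : 1 - qr k = k.+2%:R^-1.
Proof.
have k0 : k.+2%:R != 0 :> R by rewrite pnatr_eq0.
by apply: (mulIf k0); rewrite mulrBl mul1r divfK // mulVf // -(natrB _ (leqnSn _)) subSnn.
Qed.

Lemma qrX_le1 k m : qr k ^+ m <= 1.
Proof. by rewrite exprn_ile1 ?ltW ?qr_gt0 ?qr_lt1. Qed.

Lemma qrX_ge0 k m : 0 <= qr k ^+ m.
Proof. by rewrite exprn_ge0 ?ltW ?qr_gt0. Qed.

Lemma qrX_decr k m n : (m <= n)%N -> qr k ^+ n <= qr k ^+ m.
Proof. by move=> h; rewrite ler_wiXn2l ?ltW ?qr_gt0 ?qr_lt1. Qed.

Lemma bernoulli (x : R) m : 0 <= x -> x <= 1 -> 1 - m%:R * (1 - x) <= x ^+ m.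
Proof.
move=> x0 x1; elim: m => [|m IH]; first by rewrite mul0r subr0 expr0.
rewrite exprS (@le_trans _ _ (x * (1 - m%:R * (1 - x)))) ?ler_wpM2l //.
have : 0 <= m%:R * (1 - x) ^+ 2 :> R by rewrite mulr_ge0 ?sqr_ge0.
rewrite -natr1; nra.
Qed.

Lemma geometric_le k m : (1 - qr k) * \sum_(i < m) qr k ^+ i <= 1.
Proof. by rewrite -opprB mulNr -subrX1 opprB lerBlDr lerDl qrX_ge0. Qed.

(** Each of the first [m] terms of the geometric series is at least [q ^ m], hence
    [(1 - q) * m * q ^ m <= 1]; it remains to take [m] large. *)
Lemma qrX_to0 k (e : R) : 0 < e -> exists m, qr k ^+ m <= e.
Proof.
move=> e0; have q1 : 0 < 1 - qr k by rewrite subr_gt0 qr_lt1.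
pose m := Num.bound ((1 - qr k) * e)^-1; exists m.
have hm : ((1 - qr k) * e)^-1 < m%:R by apply: archi_boundP; rewrite invr_ge0 mulr_ge0 ?ltW.
have m0 : 0 < m%:R :> R by apply: lt_trans hm; rewrite invr_gt0 mulr_gt0.
have hs : (1 - qr k) * (m%:R * qr k ^+ m) <= 1.
  apply: le_trans (geometric_le k m); rewrite ler_wpM2l ?(ltW q1) //.
  rewrite mulr_natl -[X in _ *+ X]card_ord -sumr_const; apply: ler_sum => i _.
  by apply: qrX_decr; exact: ltnW.
have h2 : 1 < m%:R * ((1 - qr k) * e) by rewrite -ltr_pdivrMr ?mulr_gt0 // mul1r.
rewrite -(@ler_pM2l _ (m%:R * (1 - qr k))) ?mulr_gt0 // -!mulrA.
by rewrite [leLHS]mulrCA (le_trans hs) // ltW.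
Qed.

(* The exponent is doubled so that [q ^ (i + m)] can be split off when [i + j > m]. *)
Definition damp (k n : nat) : R := qr k ^+ (2 * plevel n).

Lemma damp_ge0 k n : 0 <= damp k n. Proof. exact: qrX_ge0. Qed.

Lemma damp_le1 k n : damp k n <= 1. Proof. exact: qrX_le1. Qed.

Lemma damp_norm k n : `|damp k n| <= 1.
Proof. by rewrite ger0_norm ?damp_ge0 ?damp_le1. Qed.

Lemma codamp_norm k n : `|1 - damp k n| <= 1.
Proof. by have := damp_ge0 k n; have := damp_le1 k n; rewrite ler_norml; lra. Qed.

Lemma dampM k m n : (0 < m)%N -> (0 < n)%N -> damp k (m * n) = damp k m * damp k n.
Proof. by move=> m0 n0; rewrite /damp plevelM // mulnDr exprD. Qed.

Lemma plevel_gt m n : (2 ^ m < n)%N -> (m < plevel n)%N.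
Proof.
move=> h; have n0 : (0 < n)%N by apply: leq_trans h.
by rewrite -(@ltn_exp2l 2) // (leq_trans h) // leq_plevel.
Qed.

Lemma damp_to0 k (e : R) : 0 < e -> exists M, forall n, (M < n)%N -> damp k n <= e.
Proof.
move=> /(qrX_to0 k)[m hm]; exists (2 ^ m)%N => n /plevel_gt h.
by apply: le_trans hm; apply: qrX_decr; lia.
Qed.

Lemma damp_to1 M (e : R) : 0 < e -> exists K, forall k, (K <= k)%N ->
  forall n, (n <= M)%N -> `|1 - damp k n| <= e.
Proof.
(* [B] dominates every exponent [2 * plevel n] with [n <= M]; Bernoulli's inequality then bounds the
   defect by [B / (k + 2)]. *)
move=> e0; pose B := (\sum_(0 <= n < M.+1) 2 * plevel n)%N.
exists (Num.bound (B%:R / e)) => k hk n hn.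
rewrite ger0_norm ?subr_ge0 ?damp_le1 // lerBlDl -lerBlDr.
apply: (le_trans _ (bernoulli _ _ _)); rewrite ?(ltW (qr_gt0 _)) ?(ltW (qr_lt1 _)) //.
rewrite lerD2l lerN2 subr_qr ler_pdivrMr //.
have hB : (2 * plevel n <= B)%N.
  have hn' : n \in index_iota 0 M.+1 by rewrite mem_index_iota.
  by rewrite /B (bigD1_seq n) ?iota_uniq //= leq_addr.
apply: (@le_trans _ _ B%:R); first by rewrite ler_nat.
rewrite -ler_pdivrMl // mulrC (le_trans (ltW (archi_boundP _))) ?divr_ge0 ?(ltW e0) //.
by rewrite ler_nat (leq_trans hk) // ltnW.
Qed.

(** Complete multiplicativity splits the multiplier between the two variables: the operator [A]
    becomes [D A D]. *)
Lemma bform_damp N k alpha a b :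
  bform N (wt (damp k) alpha) a b = bform N alpha (wt (damp k) a) (wt (damp k) b).
Proof.
apply: eq_big_nat => n /andP[n0 _]; apply: eq_big_nat => m /andP[m0 _].
by rewrite /wt dampM // rmorphM; ring.
Qed.

Lemma l2norm_damp N k a : l2norm N (wt (damp k) a) <= l2norm N a.
Proof. by apply: l2norm_wt_le => n _; exact: damp_norm. Qed.

Lemma bounded_by_damp K k alpha : 0 <= K -> bounded_by K alpha ->
  bounded_by K (wt (damp k) alpha).
Proof.
move=> K0 h N a b; rewrite bform_damp (le_trans (h _ _ _)) //.
by rewrite ler_pM ?mulr_ge0 ?l2norm_ge0 ?l2norm_damp // ler_wpM2l ?l2norm_damp.
Qed.

Lemma MH_wt w alpha : mh_bounded (wt w alpha) -> alpha 0%N = 0 -> MH (wt w alpha).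
Proof. by move=> h a0; split => //; rewrite /wt a0 mulr0. Qed.

Lemma MH_damp k alpha : MH alpha -> MH (wt (damp k) alpha).
Proof.
move=> [a0 ha]; apply: MH_wt => //; apply/mh_boundedP; exists (mh_norm alpha).
by apply: bounded_by_damp; [exact: mh_norm_ge0|exact: mh_norm_bound].
Qed.

Lemma mh_norm_damp k alpha : MH alpha -> mh_norm (wt (damp k) alpha) <= mh_norm alpha.
Proof.
move=> [a0 ha]; apply: mh_norm_le; first exact: mh_norm_ge0.
by apply: bounded_by_damp; [exact: mh_norm_ge0|exact: mh_norm_bound].
Qed.

(** In [D A D] the factor [D] meets the far coordinates first, and it is small there because
    [damp k] tends to 0. *)
Lemma MH0_damp k alpha : MH alpha -> MH0 (wt (damp k) alpha).
Proof.
move=> ha; apply/MH0P; split; first exact: MH_damp.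
move=> e e0; have K0 := mh_norm_ge0 ha.2.
have [|M hM] := @damp_to0 k (e / (mh_norm alpha + 1)).
  by rewrite divr_gt0 // ltr_wpDl.
have c0 : 0 <= e / (mh_norm alpha + 1) by rewrite divr_ge0 ?(ltW e0) ?addr_ge0.
exists M => N a b; rewrite bform_damp (le_trans (mh_norm_bound ha.2 _ _ _)) //.
rewrite ler_pM ?mulr_ge0 ?l2norm_ge0 ?l2norm_damp //.
have h : l2norm N (wt (damp k) (hi M a)) <= e / (mh_norm alpha + 1) * l2norm N a.
  rewrite /hi wt_wt; apply: l2norm_wt => // n _.
  case: ltnP => hn; rewrite ?mulr1 ?mulr0 ?normr0 //.
  by rewrite ger0_norm ?damp_ge0 ?hM.
rewrite (le_trans (ler_wpM2l K0 h)) // mulrA ler_wpM2r ?l2norm_ge0 //.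
rewrite mulrCA ler_piMr ?(ltW e0) // ler_pdivrMr ?mul1r ?lerDl //.
by rewrite ltr_wpDl.
Qed.

(* Grouping the form by the level [i] of the first variable, the part of the
   multiplier with [i + j > m] is a sum of pieces of norm at most [q ^ (m + i)]. *)
Lemma damp_finite_rank k (e : R) : 0 < e -> exists (t : nat -> R) (M : nat),
  (forall n, (M < n)%N -> t n = 0) /\
  forall K alpha, 0 <= K -> bounded_by K alpha ->
    bounded_by (e * K) (wt (fun n => damp k n - t n) alpha).
Proof.
move=> e0; have q1 : 0 < 1 - qr k by rewrite subr_gt0 qr_lt1.
have [|m hm] := @qrX_to0 k (e * (1 - qr k)); first exact: mulr_gt0.
(* The multiplier is cut to levels at most [m]; by [plevel_gt] these only occur for [n <= 2 ^ m]. *)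
exists (fun n => if (m < plevel n)%N then 0 else damp k n), (2 ^ m)%N.
split=> [n /plevel_gt -> //|K alpha K0 hK N a b].
(* A strict upper bound for the levels of all indices up to [N]. *)
pose I := (\sum_(1 <= n < N.+1) plevel n).+1.
pose P i : nat -> R := fun n => (plevel n == i)%:R.
(* The factor [qr k ^+ (2 * i)] is the damping of a first variable of level [i]; the indicator keeps
   the products of level above [m]. *)
pose Q i : nat -> R := fun n => qr k ^+ (2 * i) * ((m < i + plevel n)%:R * damp k n).
have -> : bform N (wt (fun n => damp k n - (if (m < plevel n)%N then 0 else damp k n)) alpha) a b
   = \sum_(i < I) bform N alpha (wt (P i) a) (wt (Q i) b).
  rewrite /bform [RHS]exchange_big; apply: eq_big_nat => n hn.
  rewrite [RHS]exchange_big; apply: eq_big_nat => l hl.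
  have hI : (plevel n < I)%N.
    by rewrite ltnS (bigD1_seq n) /= ?mem_index_iota ?iota_uniq ?leq_addr.
  rewrite (bigD1 (Ordinal hI)) //= big1 ?addr0; last first.
    move=> i; rewrite -val_eqE /= eq_sym => /negPf h.
    by rewrite /wt /P h !mul0r.
  have -> : wt (P (plevel n)) a n = a n by rewrite /wt /P eqxx mul1r.
  have [[n0 _] [l0 _]] := (andP hn, andP hl).
  rewrite /wt /Q plevelM // dampM //; case: ltnP => _.
    by rewrite subr0 mul1r {1}/damp !rmorphM; ring.
  by rewrite subrr mul0r mulr0 !(mulr0, mul0r).
rewrite (le_trans (cabs_sum _ _ _)) //.
have h i : cabs (bform N alpha (wt (P i) a) (wt (Q i) b)) <=
    qr k ^+ i * (qr k ^+ m * (K * l2norm N a * l2norm N b)).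
  rewrite (le_trans (hK _ _ _)) //.
  have hP : l2norm N (wt (P i) a) <= l2norm N a.
    by apply: l2norm_wt_le => n _; exact: normr_bool.
  have hQ : l2norm N (wt (Q i) b) <= qr k ^+ (i + m) * l2norm N b.
    apply: l2norm_wt; first exact: qrX_ge0.
    move=> n _; rewrite /Q; case: ltnP => h; rewrite ?mul0r ?mulr0 ?normr0 ?qrX_ge0 //.
    rewrite mul1r /damp -exprD ger0_norm ?qrX_ge0 //; apply: qrX_decr; lia.
  have -> : qr k ^+ i * (qr k ^+ m * (K * l2norm N a * l2norm N b)) =
      K * l2norm N a * (qr k ^+ (i + m) * l2norm N b) by rewrite exprD; ring.
  by rewrite ler_pM ?mulr_ge0 ?l2norm_ge0 // ler_wpM2l.
set X := K * _ * _ in h; have X0 : 0 <= X by rewrite !mulr_ge0 ?l2norm_ge0.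
apply: (@le_trans _ _ (\sum_(i < I) qr k ^+ i * (qr k ^+ m * X))).
  by apply: ler_sum => i _; exact: h.
rewrite -mulr_suml mulrA -[leRHS]mulrA -[leRHS]mulrA [K * _]mulrA -/X ler_wpM2r //.
have g := geometric_le k I; set S := \sum_(i < I) _ in g *.
have S0 : 0 <= S by apply: sumr_ge0 => i _; exact: qrX_ge0.
rewrite (le_trans (ler_wpM2l S0 hm)) //.
by rewrite mulrCA ler_piMr ?(ltW e0) // mulrC.
Qed.

(** For positive [n] the matrix of this symbol has its nonzero entries at the factorisations
    [i * j = n], so it has finite rank. *)
Definition delta (n : nat) : nat -> C := fun i => (i == n)%:R.

(** Crude count: divisors of [n] are at most [n], and each entry contributes at most the product of
    the two norms. *)
Lemma bounded_by_delta n : (0 < n)%N -> bounded_by (n%:R * n%:R) (delta n).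
Proof.
move=> n0 N a b; rewrite (le_trans (cabs_sum _ _ _)) //.
rewrite (@le_trans _ _ (\sum_(1 <= i < N.+1) \sum_(1 <= j < N.+1)
   ((i <= n)%:R * (j <= n)%:R) * (l2norm N a * l2norm N b))) //.
  rewrite big_nat [leRHS]big_nat; apply: ler_sum => i hi.
  rewrite (le_trans (cabs_sum _ _ _)) // big_nat [leRHS]big_nat.
  apply: ler_sum => j hj; rewrite /delta; case: eqP => [E|_]; last first.
    by rewrite mulr0 cabs0 !mulr_ge0 ?l2norm_ge0.
  have [[i0 _] [j0 _]] := (andP hi, andP hj).
  rewrite -E leq_pmulr // leq_pmull // !mulr1 mul1r cabsM.
  by rewrite ler_pM ?cabs_ge0 ?l2norm_coord.
under eq_bigr do rewrite -mulr_suml -mulr_sumr.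
rewrite -!mulr_suml -[leRHS]mulrA ler_wpM2r ?mulr_ge0 ?l2norm_ge0 //.
by rewrite ler_pM ?sum_indicator ?sumr_ge0.
Qed.

Lemma MH0_delta n : (0 < n)%N -> MH0 (delta n).
Proof.
move=> n0; apply/MH0P; split.
  split; first by rewrite /delta; case: n n0.
  by apply/mh_boundedP; exists (n%:R * n%:R); exact: bounded_by_delta.
move=> e e0; exists n => N a b; rewrite /bform big_nat big1 ?cabs0.
  by rewrite !mulr_ge0 ?l2norm_ge0 ?ltW.
move=> i _; rewrite big_nat big1 // => j /andP[j0 _]; rewrite /hi /wt /delta.
case: ltnP => ni; rewrite ?mul0r //; case: eqP => [E|_]; rewrite ?mulr0 //.
by move: ni; rewrite -E ltnNge leq_pmulr.
Qed.

(** * Gliding humps *)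

Definition mid (M M' : nat) : (nat -> C) -> (nat -> C) := wt (fun n => (M < n <= M')%:R).

Lemma l2norm_mid_hi N M M' a : (M <= M')%N ->
  l2norm N (mid M M' a) ^+ 2 + l2norm N (hi M' a) ^+ 2 <= l2norm N (hi M a) ^+ 2.
Proof.
move=> h; rewrite !sqr_l2norm_wt -big_split /=; apply: ler_sum => n _.
rewrite -mulrDl ler_wpM2r ?sqr_ge0 //.
have [h1|h1] := ltnP M' n; have [h2|h2] := ltnP M n;
  rewrite ?expr1n ?expr0n ?addr0 ?add0r //=; lia.
Qed.

(* A form that charges only the block [(M, M']] costs a factor [sqrt J], not [J],
   when summed over [J] successive blocks. *)
Lemma gliding_hump (I : Type) (Q : I -> Prop)
    (G : I -> nat -> (nat -> C) -> (nat -> C) -> R) (c e : R) :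
  0 <= c ->
  (forall M, exists i M', [/\ Q i, (M <= M')%N & forall N a b, G i N a b <=
     c * (l2norm N (mid M M' a) * l2norm N b + l2norm N a * l2norm N (mid M M' b))
     + e * (l2norm N a * l2norm N b)]) ->
  forall J M, exists s : nat -> I, (forall j, (j < J)%N -> Q (s j)) /\
    forall N a b, \sum_(j < J) G (s j) N a b <=
     c * Num.sqrt J%:R * (l2norm N (hi M a) * l2norm N b + l2norm N a * l2norm N (hi M b))
     + J%:R * e * (l2norm N a * l2norm N b).
Proof.
move=> c0 hG; elim=> [|J IH] M.
  (* An inhabitant of [I] is taken from the hypothesis to fill the empty family. *)
  have [i _] := hG 0%N; exists (fun=> i); split => // N a b.
  by rewrite big_ord0 sqrtr0 mulr0 !mul0r addr0.
have [i [M' [Qi MM' hi1]]] := hG M; have [s [Qs hs]] := IH M'.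
exists (fun j => if j is j'.+1 then s j' else i); split; first by case.
move=> N a b; rewrite big_ord_recl /=; have h1 := hi1 N a b; have h2 := hs N a b.
(* The first block costs 1 and the [J] blocks beyond [M'] cost [sqrt J]. They act on orthogonal
   parts of the vector, so Cauchy-Schwarz gives [sqrt (J + 1)]. *)
have cs x : l2norm N (mid M M' x) + Num.sqrt J%:R * l2norm N (hi M' x) <=
    Num.sqrt J.+1%:R * l2norm N (hi M x).
  rewrite -[X in X + _]mulr1 [_ * l2norm N (hi M' x)]mulrC [leRHS]mulrC.
  apply: cauchy_schwarz2; rewrite ?l2norm_ge0 ?sqrtr_ge0 ?l2norm_mid_hi //.
  by rewrite !sqr_sqrtr // expr1n -natr1 addrC.
have ha := ler_wpM2r (l2norm_ge0 N b) (cs a).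
have hb := ler_wpM2l (l2norm_ge0 N a) (cs b).
have hc := ler_wpM2l c0 (lerD ha hb).
have -> : J.+1%:R * e = e + J%:R * e by rewrite -natr1; ring.
move: h1 h2 hc; lra.
Qed.

(** * Dual spaces *)

(** A seminormed space; homogeneity and the triangle inequality are combined in one bound on
    [lincomb]. *)
Record normed (X : Type) (S : set (X -> C)) (nrm : (X -> C) -> R) : Prop := Normed {
  normed0 : S (fun=> 0);
  normedL : forall c x y, S x -> S y -> S (lincomb c x y);
  nrm0 : nrm (fun=> 0) = 0;
  nrm_ge0 : forall x, S x -> 0 <= nrm x;
  nrm_lincomb : forall c x y, S x -> S y -> nrm (lincomb c x y) <= cabs c * nrm x + nrm y
}.

Definition lsum (X : Type) (J : nat) (c : nat -> C) (x : nat -> X -> C) : X -> C :=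
  fun t => \sum_(j < J) c j * x j t.

(** Enforces the convention that elements of [dual] vanish outside the space they act on. *)
Definition restr (X : Type) (S : set (X -> C)) (f : (X -> C) -> C) : (X -> C) -> C :=
  fun x => if `[< S x >] then f x else 0.

Lemma restr_in (X : Type) (S : set (X -> C)) f x : S x -> restr S f x = f x.
Proof. by move=> h; rewrite /restr asboolT. Qed.

Lemma restr_out (X : Type) (S : set (X -> C)) f x : ~ S x -> restr S f x = 0.
Proof. by move=> h; rewrite /restr asboolF. Qed.

Section DualSpace.
Variables (X : Type) (S : set (X -> C)) (nrm : (X -> C) -> R).
Hypothesis nS : normed S nrm.

Lemma lsum_in J c x : (forall j, (j < J)%N -> S (x j)) -> S (lsum J c x).
Proof.
elim: J => [|J IH] h.
  have -> : lsum 0 c x = (fun=> 0) by apply: funext => t; rewrite /lsum big_ord0.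
  exact: normed0 nS.
have -> : lsum J.+1 c x = lincomb (c J) (x J) (lsum J c x).
  by apply: funext => t; rewrite /lsum /lincomb big_ord_recr addrC.
by apply: (normedL nS) => //; [exact: h|apply: IH => j hj; apply: h; exact: ltnW].
Qed.

Lemma dual0 f : dual S nrm f -> f (fun=> 0) = 0.
Proof.
move=> [fL _]; have S0 := normed0 nS.
have E : lincomb (-1) (fun=> 0) (fun=> 0) = (fun=> 0) :> (X -> C).
  by apply: funext => t; rewrite /lincomb mulr0 addr0.
by have := fL (-1) _ _ S0 S0; rewrite E mulN1r addNr.
Qed.

Lemma dual_lsum f J c x : dual S nrm f -> (forall j, (j < J)%N -> S (x j)) ->
  f (lsum J c x) = \sum_(j < J) c j * f (x j).
Proof.
move=> fd; elim: J => [|J IH] h.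
  have -> : lsum 0 c x = (fun=> 0) by apply: funext => t; rewrite /lsum big_ord0.
  by rewrite big_ord0 (dual0 fd).
have -> : lsum J.+1 c x = lincomb (c J) (x J) (lsum J c x).
  by apply: funext => t; rewrite /lsum /lincomb big_ord_recr addrC.
have hJ j : (j < J)%N -> S (x j) by move=> hj; apply: h; exact: ltnW.
by rewrite fd.1 ?IH ?big_ord_recr 1?addrC //; [exact: h|exact: lsum_in].
Qed.

Lemma dualZ f c x : dual S nrm f -> S x -> f (lincomb c x (fun=> 0)) = c * f x.
Proof. by move=> fd Sx; rewrite fd.1 ?(dual0 fd) ?addr0 //; exact: normed0 nS. Qed.

Lemma dualB f x y : dual S nrm f -> S x -> S y -> f (lincomb (-1) y x) = f x - f y.
Proof. by move=> fd Sx Sy; rewrite fd.1 // mulN1r addrC. Qed.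

Lemma nrmZ c x : S x -> nrm (lincomb c x (fun=> 0)) <= cabs c * nrm x.
Proof.
move=> Sx; have := nrm_lincomb nS c Sx (normed0 nS); by rewrite (nrm0 nS) addr0.
Qed.

Lemma normedZ c x : S x -> S (lincomb c x (fun=> 0)).
Proof. by move=> Sx; apply: (normedL nS) => //; exact: normed0 nS. Qed.

Lemma dual_norm_ub f x : dual S nrm f -> S x -> nrm x <= 1 -> cabs (f x) <= dual_norm S nrm f.
Proof.
move=> [_ [[K hK] _]] Sx x1; apply: ub_le_sup; last by exists x.
exists `|K| => _ [y [Sy [y1 ->]]]; rewrite (le_trans (hK _ Sy)) //.
rewrite (le_trans (ler_norm _)) // normrM ler_piMr // ger0_norm //.
exact: nrm_ge0 nS _ Sy.
Qed.

Lemma dual_norm_le1 f K : (forall x, S x -> nrm x <= 1 -> cabs (f x) <= K) ->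
  dual_norm S nrm f <= K.
Proof.
move=> h; apply: ge_sup; last by move=> _ [x [Sx [x1 ->]]]; exact: h.
exists (cabs (f (fun=> 0))), (fun=> 0); split; first exact: normed0 nS.
by rewrite (nrm0 nS).
Qed.

Lemma dual_norm_le f K : 0 <= K -> (forall x, S x -> cabs (f x) <= K * nrm x) ->
  dual_norm S nrm f <= K.
Proof.
move=> K0 h; apply: dual_norm_le1 => x Sx x1; rewrite (le_trans (h _ Sx)) //.
by rewrite ler_piMr.
Qed.

Lemma dual_norm_ge0 f : dual S nrm f -> 0 <= dual_norm S nrm f.
Proof.
move=> fd; have S0 := normed0 nS.
by apply: le_trans (dual_norm_ub fd S0 _); rewrite ?cabs_ge0 // (nrm0 nS).
Qed.

Lemma dual_normP f x : dual S nrm f -> S x -> cabs (f x) <= dual_norm S nrm f * nrm x.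
Proof.
move=> fd Sx; have [x0|x0] := eqVneq (nrm x) 0.
  by have [_ [[K hK] _]] := fd; have := hK _ Sx; rewrite x0 !mulr0.
have px : 0 < nrm x by rewrite lt_def x0 (nrm_ge0 nS).
have ab : cabs (nrm x)^-1%:C = (nrm x)^-1 by rewrite cabs_real ger0_norm // invr_ge0 ltW.
have := dual_norm_ub fd (normedZ (nrm x)^-1%:C Sx).
rewrite (dualZ _ fd Sx) cabsM ab ler_pdivrMl // mulrC; apply.
by rewrite (le_trans (nrmZ _ Sx)) // ab mulVf.
Qed.

Lemma dual_ext f g : dual S nrm f -> dual S nrm g -> (forall x, S x -> f x = g x) -> f = g.
Proof.
move=> fd gd h; apply: funext => x; have [/h//|nx] := pselect (S x).
by rewrite fd.2.2 // gd.2.2.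
Qed.

Lemma dual_restr f K : (forall c x y, S x -> S y -> f (lincomb c x y) = c * f x + f y) ->
  (forall x, S x -> cabs (f x) <= K * nrm x) -> dual S nrm (restr S f).
Proof.
move=> fL fK; split.
  by move=> c x y Sx Sy; rewrite !restr_in //; [exact: fL|exact: (normedL nS)].
split; last by move=> x; exact: restr_out.
by exists K => x Sx; rewrite restr_in // fK.
Qed.

Lemma dual_lincomb c f g : dual S nrm f -> dual S nrm g -> dual S nrm (lincomb c f g).
Proof.
move=> fd gd; split; first by move=> d x y Sx Sy; rewrite /lincomb fd.1 // gd.1 //; ring.
split; last by move=> x nx; rewrite /lincomb fd.2.2 // gd.2.2 // mulr0 addr0.
exists (cabs c * dual_norm S nrm f + dual_norm S nrm g) => x Sx.
rewrite /lincomb (le_trans (cabsD _ _)) // cabsM mulrDl -mulrA.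
by rewrite lerD ?dual_normP // ler_wpM2l ?cabs_ge0 ?dual_normP.
Qed.

(** Makes the preceding lemmas applicable to the dual itself, hence to the bidual. *)
Lemma dual_normed : normed (dual S nrm) (dual_norm S nrm).
Proof.
split.
- split; first by move=> *; rewrite mulr0 addr0.
  split => //; exists 0 => x _; by rewrite cabs0 mul0r.
- exact: dual_lincomb.
- apply/le_anti/andP; split; first by apply: dual_norm_le => // x _; rewrite cabs0 mul0r.
  rewrite -cabs0; apply: (@dual_norm_ub (fun=> 0) (fun=> 0)); last by rewrite (nrm0 nS).
    by split=> [*|]; rewrite ?mulr0 ?addr0 //; split => //; exists 0 => x _; rewrite cabs0 mul0r.
  exact: normed0 nS.
- exact: dual_norm_ge0.
move=> c f g fd gd; apply: dual_norm_le.
  by rewrite addr_ge0 ?mulr_ge0 ?cabs_ge0 ?dual_norm_ge0.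
move=> x Sx; rewrite /lincomb (le_trans (cabsD _ _)) // cabsM mulrDl -mulrA.
by rewrite lerD ?dual_normP // ler_wpM2l ?cabs_ge0 ?dual_normP.
Qed.

End DualSpace.

(** * Bounded and compact symbols as seminormed spaces *)

Lemma bounded_by_zero : bounded_by 0 (fun=> 0).
Proof.
move=> N a b; rewrite /bform big1 ?cabs0 ?mul0r // => n _.
by rewrite big1 // => m _; rewrite mulr0.
Qed.

Lemma MH_zero : MH (fun=> 0).
Proof. by split => //; apply/mh_boundedP; exists 0; exact: bounded_by_zero. Qed.

Lemma mh_norm_zero : mh_norm (fun=> 0) = 0.
Proof.
by apply/le_anti; rewrite (mh_norm_le _ bounded_by_zero) // mh_norm_ge0 //; exact: MH_zero.2.
Qed.

Lemma MH_normed : normed MH mh_norm.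
Proof.
split; [exact: MH_zero|exact: MH_lincomb|exact: mh_norm_zero| |exact: mh_norm_lincomb].
by move=> a [_ h]; exact: mh_norm_ge0.
Qed.

Lemma tail_small_lincomb c alpha beta : tail_small alpha -> tail_small beta ->
  tail_small (lincomb c alpha beta).
Proof.
move=> ha hb e e0; have e2 : 0 < e / 2 by rewrite divr_gt0.
have c1 : 0 < cabs c + 1 by rewrite ltr_wpDl ?cabs_ge0.
have [M1 h1] := ha _ (divr_gt0 e2 c1); have [M2 h2] := hb _ e2.
exists (maxn M1 M2) => N a b; set a' := hi _ a.
have la : l2norm N a' <= l2norm N a by exact: l2norm_hi.
have := h1 N a' b; have := h2 N a' b.
rewrite /a' !hi_hi ?leq_maxl ?leq_maxr // -/a' bform_lincomb => h3 h4.
rewrite (le_trans (cabsD _ _)) // cabsM [e]splitr !mulrDl lerD //.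
  rewrite (@le_trans _ _ ((cabs c + 1) * cabs (bform N alpha a' b))) //.
    by rewrite ler_wpM2r ?cabs_ge0 // lerDl.
  apply: (le_trans (ler_wpM2l (ltW c1) h4)).
  have -> : (cabs c + 1) * (e / 2 / (cabs c + 1) * l2norm N a' * l2norm N b) =
      e / 2 * l2norm N a' * l2norm N b by field; rewrite gt_eqF.
  by rewrite ler_wpM2r ?l2norm_ge0 // ler_wpM2l ?(ltW e2).
by rewrite (le_trans h3) // ler_wpM2r ?l2norm_ge0 // ler_wpM2l ?(ltW e2).
Qed.

Lemma MH0_normed : normed MH0 mh_norm.
Proof.
split.
- apply/MH0P; split; first exact: normed0 MH_normed.
  move=> e e0; exists 0%N => N a b; rewrite /bform big1 ?cabs0 ?mulr_ge0 ?l2norm_ge0 ?ltW //.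
  by move=> n _; rewrite big1 // => m _; rewrite mulr0.
- move=> c x y /MH0P[x1 x2] /MH0P[y1 y2]; apply/MH0P; split; first exact: MH_lincomb.
  exact: tail_small_lincomb.
- exact: mh_norm_zero.
- by move=> x [[_ h] _]; exact: mh_norm_ge0.
by move=> c x y [hx _] [hy _]; exact: mh_norm_lincomb.
Qed.

(** * Dampings converge to the identity on functionals *)

Definition codamp (k n : nat) : R := 1 - damp k n.

(** The operator identity [A - D A D = A (1 - D) + (1 - D) A D], read on the form. *)
Lemma bform_codamp N k alpha a b :
  bform N (lincomb (-1) (wt (damp k) alpha) alpha) a b =
  bform N alpha (wt (codamp k) a) b + bform N alpha (wt (damp k) a) (wt (codamp k) b).
Proof.
have hd n : (1 <= n <= N)%N -> (fun=> 1 : R) n = codamp k n + damp k n.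
  by move=> _; rewrite /codamp subrK.
rewrite bform_lincomb bform_damp mulN1r -[in bform N alpha a b](wt1 a).
rewrite (bform_wtDl _ _ _ hd) -[in bform N alpha (wt (damp k) a) b](wt1 b).
by rewrite (bform_wtDr _ _ _ hd); ring.
Qed.

Lemma l2norm_codamp N k a : l2norm N (wt (codamp k) a) <= l2norm N a.
Proof. by apply: l2norm_wt_le => n _; exact: codamp_norm. Qed.

Lemma l2norm_codamp_lo N k M (d : R) a : 0 <= d ->
  (forall n, (n <= M)%N -> `|1 - damp k n| <= d) ->
  l2norm N (wt (codamp k) (lo M a)) <= d * l2norm N a.
Proof.
move=> d0 h; rewrite /lo wt_wt; apply: l2norm_wt => // n _.
by case: leqP => hn; rewrite ?mulr0 ?mulr1 ?normr0 // h.
Qed.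

Lemma bform_le_of N alpha a b (K x y : R) : 0 <= K -> bounded_by K alpha ->
  l2norm N a <= x -> l2norm N b <= y -> cabs (bform N alpha a b) <= K * x * y.
Proof.
move=> K0 hK ha hb; rewrite (le_trans (hK _ _ _)) //.
by rewrite ler_pM ?mulr_ge0 ?l2norm_ge0 // ler_wpM2l.
Qed.

Lemma lo_splitE M M' n : (M <= M')%N -> (n <= M')%:R = (n <= M)%:R + (M < n <= M')%:R :> R.
Proof.
by move=> h; have [h1|h1] := leqP n M; rewrite /= ?addr0 ?add0r // (leq_trans h1 h).
Qed.

(** Supplies the hypothesis of [gliding_hump]: up to [M] the damping is nearly the identity, beyond
    some [M'] the compact difference is small, and the rest charges only the block between. *)
Lemma codamp_block k alpha (e : R) M : bounded_by 1 alpha ->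
  tail_small (lincomb (-1) (wt (damp k) alpha) alpha) -> 0 < e ->
  (forall n, (n <= M)%N -> `|1 - damp k n| <= e / 4) ->
  exists2 M', (M <= M')%N & forall N a b,
    cabs (bform N (lincomb (-1) (wt (damp k) alpha) alpha) a b) <=
    2 * (l2norm N (mid M M' a) * l2norm N b + l2norm N a * l2norm N (mid M M' b))
    + e * (l2norm N a * l2norm N b).
Proof.
set beta := lincomb _ _ _ => hal ht e0 hd.
have e4 : 0 < e / 4 by rewrite divr_gt0.
have hb : bounded_by 2 beta.
  have -> : 2 = cabs (-1) * 1 + 1 :> R by rewrite cabsN cabs1; ring.
  by apply: bounded_by_lincomb => //; exact: bounded_by_damp.
have [M0 hM0] := ht _ e4; pose M' := maxn M M0.
have MM' : (M <= M')%N by exact: leq_maxl.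
have tl N a b : cabs (bform N beta (hi M' a) b) <= e / 4 * l2norm N a * l2norm N b.
  rewrite -(hi_hi _ (leq_maxr M M0)) (le_trans (hM0 _ _ _)) //.
  by rewrite ler_wpM2r ?l2norm_ge0 // ler_wpM2l ?(ltW e4) ?l2norm_hi.
exists M' => // N a b.
have spl n : (1 <= n <= N)%N -> (n <= M')%:R = (n <= M)%:R + (M < n <= M')%:R :> R.
  by move=> _; exact: lo_splitE.
(* The head-head piece is small by the choice of [k] and the last two pieces by the tail bound. The
   two pieces containing [mid] carry the constant 2, the norm bound of [beta]. *)
have -> : bform N beta a b = bform N beta (lo M a) (lo M b) + bform N beta (lo M a) (mid M M' b)
   + bform N beta (mid M M' a) (lo M' b) + bform N beta (lo M' a) (hi M' b)
   + bform N beta (hi M' a) b.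
  rewrite (bform_lo_hi_l _ _ M') (bform_lo_hi_r _ _ M' (lo M' a)).
  by rewrite (bform_wtDl _ _ _ spl) (bform_wtDr _ _ _ spl).
have A0 := l2norm_ge0 N a; have B0 := l2norm_ge0 N b.
have k1 : cabs (bform N beta (lo M a) (lo M b)) <= e / 2 * (l2norm N a * l2norm N b).
  rewrite bform_codamp (le_trans (cabsD _ _)) //.
  have x1 := bform_le_of ler01 hal (l2norm_codamp_lo N a (ltW e4) hd) (l2norm_lo N M b).
  have x2 := bform_le_of ler01 hal (le_trans (l2norm_damp N k (lo M a)) (l2norm_lo N M a))
    (l2norm_codamp_lo N b (ltW e4) hd).
  rewrite !mul1r in x1 x2; move: x1 x2; lra.
have k2 := bform_le_of (ler0n _ 2) hb (l2norm_lo N M a) (lexx (l2norm N (mid M M' b))).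
have k3 := bform_le_of (ler0n _ 2) hb (lexx (l2norm N (mid M M' a))) (l2norm_lo N M' b).
have k4 : cabs (bform N beta (lo M' a) (hi M' b)) <= e / 4 * (l2norm N a * l2norm N b).
  rewrite bform_sym (le_trans (tl _ _ _)) // -mulrA ler_wpM2l ?(ltW e4) // mulrC.
  by rewrite ler_wpM2r // l2norm_lo.
have k5 := tl N a b.
move: k1 k2 k3 k4 k5; set x1 := bform N beta (lo M a) (lo M b).
set x2 := bform N beta _ (mid _ _ _); set x3 := bform N beta (mid _ _ _) _.
set x4 := bform N beta _ (hi _ _); set x5 := bform N beta (hi _ _) _.
have t1 := cabsD x1 x2; have t2 := cabsD (x1 + x2) x3.
have t3 := cabsD (x1 + x2 + x3) x4; have t4 := cabsD (x1 + x2 + x3 + x4) x5.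
lra.
Qed.

Lemma mh_norm_scaled alpha : MH0 alpha -> mh_norm alpha != 0 ->
  forall c : C, cabs c = 1 -> exists alpha', [/\ MH0 alpha', bounded_by 1 alpha' &
    alpha' = lincomb (c * (mh_norm alpha)^-1%:C) alpha (fun=> 0)].
Proof.
move=> ha n0 c c1; eexists; split; last reflexivity; first exact: (normedZ MH0_normed).
have p : 0 < mh_norm alpha by rewrite lt_def n0 mh_norm_ge0 //; exact: ha.1.2.
have := bounded_by_lincomb (c * (mh_norm alpha)^-1%:C) (mh_norm_bound ha.1.2) bounded_by_zero.
by rewrite cabsM c1 mul1r cabs_real ger0_norm ?invr_ge0 ?(ltW p) // mulVf // addr0.
Qed.

(** Otherwise arbitrarily late dampings give differences [alpha - d_k alpha], with [alpha] in the
    unit ball, on which [f] is real and at least [e]. Summing [m * m] of them along successive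
    blocks makes [f] at least [m * m * e] while the norm is about [4 * m], which is impossible for
    large [m]. *)
Lemma functional_damp f (e : R) : dual MH0 mh_norm f -> 0 < e ->
  exists K, forall k, (K <= k)%N -> forall alpha, MH0 alpha ->
    cabs (f alpha - f (wt (damp k) alpha)) <= e * mh_norm alpha.
Proof.
move=> fd e0; apply: contrapT => /forallNP hn; have nM := MH0_normed.
pose F := dual_norm MH0 mh_norm f + 1.
have F0 : 0 < F by rewrite ltr_wpDl // dual_norm_ge0.
(* Chosen so that the error term of the gliding hump, multiplied by [F], is half of the lower bound
   [m * m * e]. *)
pose e' := e / (2 * F); have e'0 : 0 < e' by rewrite divr_gt0 // mulr_gt0.
pose Q beta := MH0 beta /\ exists2 r : R, e <= r & f beta = r%:C.
have hQ M : exists beta M', [/\ Q beta, (M <= M')%N & forall N a b,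
    cabs (bform N beta a b) <=
    2 * (l2norm N (mid M M' a) * l2norm N b + l2norm N a * l2norm N (mid M M' b))
    + e' * (l2norm N a * l2norm N b)].
  have [|K hK] := @damp_to1 M (e' / 4); first by rewrite divr_gt0.
  have /existsNP[k /not_implyP[Kk /existsNP[alpha /not_implyP[ha /negP]]]] := hn K.
  rewrite -ltNge => hlt; set z := f alpha - _ in hlt.
  have hda := MH0_damp k ha.1.
  (* If the norm were 0, [f] would vanish on both [alpha] and its damping, against [hlt]. *)
  have n0 : mh_norm alpha != 0.
    apply/eqP => E; have := dual_normP nM fd ha; have := dual_normP nM fd hda.
    have E' : mh_norm (wt (damp k) alpha) = 0.
      apply/le_anti; rewrite -{1}E mh_norm_damp ?mh_norm_ge0 //; first exact: hda.1.2.
      exact: ha.1.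
    rewrite E E' !mulr0 => h1 h2; move: hlt; rewrite E mulr0 /z.
    have := cabsD (f alpha) (- f (wt (damp k) alpha)); rewrite cabsN; lra.
  have p : 0 < mh_norm alpha by rewrite lt_def n0 mh_norm_ge0 //; exact: ha.1.2.
  have [c c1 cz] := cabs_phase z.
  have [al' [m1 b1 E]] := mh_norm_scaled ha n0 c1.
  pose beta := lincomb (-1) (wt (damp k) al') al'.
  have mb : MH0 beta by apply: (normedL nM) => //; apply: MH0_damp; exact: m1.1.
  have [_ tb] := (MH0P beta).1 mb.
  have [M' h1 h2] := codamp_block b1 tb e'0 (hK _ Kk).
  exists beta, M'; split => //; split => //; exists (cabs z / mh_norm alpha).
    by rewrite ler_pdivlMr // ltW.
  rewrite /beta (dualB fd) //; last by apply: MH0_damp; exact: m1.1.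
  have -> : wt (damp k) al' = lincomb (c * (mh_norm alpha)^-1%:C) (wt (damp k) alpha) (fun=> 0).
    by rewrite E; apply: funext => n; rewrite /wt /lincomb; ring.
  rewrite E !(dualZ nM _ fd) // -mulrBr -/z mulrAC cz -rmorphM.
  by congr (_%:C); rewrite mulrC.
(* The number of terms is a square so that its root is [m]; [m > 8 * F / e] makes [m * e / 2] exceed
   [4 * F]. *)
pose m := (Num.bound (8 * F / e)).+1.
have hm : 8 * F / e < m%:R.
  by rewrite (lt_trans (archi_boundP _)) ?ltr_nat // divr_ge0 ?mulr_ge0 ?ltW.
have m0 : 0 < m%:R :> R by rewrite ltr0n.
have [s [Qs hs]] := gliding_hump (ler0n R 2) hQ (m * m) 0.
pose B := lsum (m * m) (fun=> 1) s.
have Bb : bounded_by (4 * m%:R + m%:R * m%:R * e') B.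
  move=> N a b; have -> : bform N B a b = \sum_(j < m * m) bform N (s j) a b.
    rewrite /bform [RHS]exchange_big; apply: eq_bigr => n _ /=.
    rewrite [RHS]exchange_big; apply: eq_bigr => l _ /=.
    by rewrite /B /lsum mulr_sumr; apply: eq_bigr => j _; rewrite mul1r.
  rewrite (le_trans (cabs_sum _ _ _)) // (le_trans (hs _ _ _)) //.
  rewrite natrM -expr2 sqrtr_sqr ger0_norm ?(ltW m0) // expr2.
  have A0 := l2norm_ge0 N a; have B0 := l2norm_ge0 N b.
  have ha := ler_wpM2r B0 (l2norm_hi N 0 a); have hb := ler_wpM2l A0 (l2norm_hi N 0 b).
  have := ler_wpM2l (mulr_ge0 (ler0n R 2) (ltW m0)) (lerD ha hb); lra.
have sMH j : (j < m * m)%N -> MH0 (s j) by move=> /Qs[].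
have BM : MH0 B by exact: (lsum_in nM).
have Bn : mh_norm B <= 4 * m%:R + m%:R * m%:R * e'.
  apply: mh_norm_le => //; apply: addr_ge0; first exact: mulr_ge0 (ler0n _ _) (ltW m0).
  exact: mulr_ge0 (mulr_ge0 (ltW m0) (ltW m0)) (ltW e'0).
have fB : m%:R * m%:R * e <= cabs (f B).
  apply: le_trans (cabs_Re _); apply: le_trans (ler_norm _).
  rewrite (dual_lsum nM _ fd sMH) raddf_sum /=.
  rewrite -natrM mulr_natl -[X in _ *+ X]card_ord -sumr_const; apply: ler_sum => j _.
  by have [_ [r hr ->]] := Qs j (ltn_ord j); rewrite mul1r.
have := le_trans fB (le_trans (dual_normP nM fd BM) _).
have hF : dual_norm MH0 mh_norm f * mh_norm B <= F * (4 * m%:R + m%:R * m%:R * e').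
  rewrite ler_pM ?dual_norm_ge0 ?lerDl //; first by apply: mh_norm_ge0; exact: BM.1.2.
move=> /(_ _ hF); have -> : F * (4 * m%:R + m%:R * m%:R * e') = m%:R * (4 * F + m%:R * e / 2).
  by rewrite /e'; field; rewrite gt_eqF.
rewrite -mulrA ler_pM2l //; rewrite ltr_pdivrMr // in hm; lra.
Qed.

(** * Limits of complex sequences *)

Lemma real_cauchy (u : nat -> R) :
  (forall e : R, 0 < e -> exists K, forall k l, (K <= k)%N -> (K <= l)%N -> `|u k - u l| <= e) ->
  exists x, forall e : R, 0 < e -> exists K, forall k, (K <= k)%N -> `|u k - x| <= e.
Proof.
(* The limit will be the supremum of the eventual lower bounds. *)
move=> hu; pose E := [set y : R | exists K, forall k, (K <= k)%N -> y <= u k].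
have win e : 0 < e -> exists K, forall k, (K <= k)%N ->
    E (u k - e) /\ forall y, E y -> y <= u k + e.
  move=> e0; have [K hK] := hu e e0; exists K => k hk; split.
    by exists K => l hl; have := hK k l hk hl; rewrite ler_norml; lra.
  move=> y [L hL]; have := hK k (maxn K L) hk (leq_maxl _ _).
  by have := hL (maxn K L) (leq_maxr _ _); rewrite ler_norml; lra.
have hE : has_sup E.
  have [K /(_ K (leqnn _))[h1 h2]] := win 1 ltr01; split; first by exists (u K - 1).
  by exists (u K + 1) => y; exact: h2.
exists (sup E) => e e0; have [K hK] := win _ e0; exists K => k /hK[h1 h2].
have := ub_le_sup hE.2 h1; have := ge_sup hE.1 h2; rewrite ler_norml; lra.
Qed.

Definition tends (u : nat -> C) (z : C) : Prop :=
  forall e : R, 0 < e -> exists K, forall k, (K <= k)%N -> cabs (u k - z) <= e.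

Lemma complex_cauchy (u : nat -> C) :
  (forall e : R, 0 < e -> exists K, forall k l, (K <= k)%N -> (K <= l)%N ->
    cabs (u k - u l) <= e) -> exists z, tends u z.
Proof.
move=> hu.
have [|x hx] := @real_cauchy (fun k => complex.Re (u k)).
  move=> e /hu[K hK]; exists K => k l hk hl; apply: le_trans (hK k l hk hl).
  by rewrite -raddfB; exact: cabs_Re.
have [|y hy] := @real_cauchy (fun k => complex.Im (u k)).
  move=> e /hu[K hK]; exists K => k l hk hl; apply: le_trans (hK k l hk hl).
  by rewrite -raddfB; exact: cabs_Im.
exists (Complex x y) => e e0; have e2 : 0 < e / 2 by rewrite divr_gt0.
have [K1 h1] := hx _ e2; have [K2 h2] := hy _ e2; exists (maxn K1 K2) => k.
rewrite geq_max => /andP[/h1 h3 /h2 h4]; rewrite (le_trans (cabs_le_ReIm _)) //.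
by rewrite !raddfB /= [e]splitr lerD.
Qed.

Lemma tends_le u z (c : R) : tends u z -> (forall k, cabs (u k) <= c) -> cabs z <= c.
Proof.
move=> hz hu; apply/ler_addgt0Pr => e /hz[K /(_ K (leqnn _)) h].
rewrite -[z](subrK (u K)) (le_trans (cabsD _ _)) // addrC lerD // cabsB //.
Qed.

Lemma tends_unique u z z' : tends u z -> tends u z' -> z = z'.
Proof.
move=> hz hz'; apply/eqP; rewrite -subr_eq0; apply/eqP/cabs_eq0.
apply/le_anti; rewrite cabs_ge0 andbT; apply/ler_addgt0Pr => e e0; rewrite add0r.
have e2 : 0 < e / 2 by rewrite divr_gt0.
have [K h] := hz _ e2; have [K' h'] := hz' _ e2.
have := h _ (leq_maxl K K'); have := h' _ (leq_maxr K K'); set w := u _ => x1 x2.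
have := cabsD (z - w) (w - z'); rewrite addrA subrK cabsB; lra.
Qed.

Lemma tends_lincomb c u v z w : tends u z -> tends v w ->
  tends (fun k => c * u k + v k) (c * z + w).
Proof.
move=> hu hv e e0; have e2 : 0 < e / 2 by rewrite divr_gt0.
have c1 : 0 < cabs c + 1 by rewrite ltr_wpDl ?cabs_ge0.
have [K h] := hu _ (divr_gt0 e2 c1); have [K' h'] := hv _ e2.
exists (maxn K K') => k; rewrite geq_max => /andP[/h h1 /h' h2].
have -> : c * u k + v k - (c * z + w) = c * (u k - z) + (v k - w) by ring.
rewrite (le_trans (cabsD _ _)) // cabsM [e]splitr lerD //.
rewrite (@le_trans _ _ ((cabs c + 1) * cabs (u k - z))) //.
  by rewrite ler_wpM2r ?cabs_ge0 // lerDl.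
by rewrite mulrC -ler_pdivlMr.
Qed.

(** * Extension of functionals from compact to bounded symbols *)

Lemma wt_comm u v a : wt u (wt v a) = wt v (wt u a).
Proof. by rewrite !wt_wt; congr (wt _ a); apply: funext => n; rewrite mulrC. Qed.

(** [functional_damp] only speaks of compact symbols, and [alpha] is merely bounded. Dampings
    commute, so [d_k alpha] is compared with [d_L d_k alpha = d_k d_L alpha] and this with
    [d_L alpha], all of them compact. [L] may depend on [alpha], since its error [d] is
    arbitrary. *)
Lemma functional_damp_cauchy f (e : R) : dual MH0 mh_norm f -> 0 < e ->
  exists K, forall k l, (K <= k)%N -> (K <= l)%N -> forall alpha, MH alpha ->
    cabs (f (wt (damp k) alpha) - f (wt (damp l) alpha)) <= e * mh_norm alpha.
Proof.
move=> fd e0; have e2 : 0 < e / 2 by rewrite divr_gt0.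
have [K hK] := functional_damp fd e2; exists K => k l hk hl alpha ha.
have A0 := mh_norm_ge0 ha.2.
apply/ler_addgt0Pr => d d0.
pose d' := d / (2 * (mh_norm alpha + 1)).
have d'0 : 0 < d' by rewrite divr_gt0 // mulr_gt0 // ltr_wpDl.
have [L hL] := functional_damp fd d'0.
pose x j := wt (damp j) alpha; rewrite -!/(x _).
have mx j : MH0 (x j) by exact: MH0_damp.
have nx j : mh_norm (x j) <= mh_norm alpha by exact: mh_norm_damp.
have far j : cabs (f (x j) - f (wt (damp L) (x j))) <= d / 2.
  rewrite (le_trans (hL _ (leqnn _) _ (mx j))) //.
  rewrite (@le_trans _ _ (d' * (mh_norm alpha + 1))) //.
    by rewrite ler_wpM2l ?(ltW d'0) // (le_trans (nx j)) // lerDl.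
  by rewrite /d' invfM mulrA divfK // gt_eqF // ltr_wpDl.
have near j : (K <= j)%N -> cabs (f (x L) - f (wt (damp L) (x j))) <= e / 2 * mh_norm alpha.
  move=> hj; rewrite wt_comm (le_trans (hK _ hj _ (mx L))) //.
  by rewrite ler_wpM2l ?(ltW e2).
have := far k; have := far l; have := near _ hk; have := near _ hl.
set fk := f (x k); set fl := f (x l); set fL := f (x L).
set gk := f (wt _ (x k)); set gl := f (wt _ (x l)).
have -> : fk - fl = (fk - gk) + (gk - fL) + (fL - gl) + (gl - fl) by ring.
have t1 := cabsD (fk - gk) (gk - fL); have t2 := cabsD (fk - gk + (gk - fL)) (fL - gl).
have t3 := cabsD (fk - gk + (gk - fL) + (fL - gl)) (gl - fl).
rewrite (cabsB gk) in t1; rewrite (cabsB gl) in t3; lra.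
Qed.

Lemma functional_damp_tends f alpha : dual MH0 mh_norm f -> MH alpha ->
  exists z, tends (fun k => f (wt (damp k) alpha)) z.
Proof.
move=> fd ha; apply: complex_cauchy => e e0; have A0 := mh_norm_ge0 ha.2.
have p : 0 < mh_norm alpha + 1 by rewrite ltr_wpDl.
have [K hK] := functional_damp_cauchy fd (divr_gt0 e0 p).
exists K => k l hk hl; rewrite (le_trans (hK _ _ hk hl _ ha)) //.
by rewrite mulrAC ler_pdivrMr // ler_wpM2l ?(ltW e0) // lerDl.
Qed.

(** For [f] in the dual of [MH0] the limit exists by [functional_damp_tends], so the default 0 of
    [xget] is not reached. *)
Definition ext (f : (nat -> C) -> C) : (nat -> C) -> C :=
  restr MH (fun alpha => xget 0 [set z | tends (fun k => f (wt (damp k) alpha)) z]).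

Lemma ext_tends f alpha : dual MH0 mh_norm f -> MH alpha ->
  tends (fun k => f (wt (damp k) alpha)) (ext f alpha).
Proof.
move=> fd ha; rewrite /ext restr_in //.
by have [z hz] := functional_damp_tends fd ha; exact: xgetI hz.
Qed.

Lemma ext_eq f alpha z : dual MH0 mh_norm f -> MH alpha ->
  tends (fun k => f (wt (damp k) alpha)) z -> ext f alpha = z.
Proof. by move=> fd ha; apply: tends_unique; exact: ext_tends. Qed.

Lemma wt_lincomb w c a b : wt w (lincomb c a b) = lincomb c (wt w a) (wt w b).
Proof. by apply: funext => n; rewrite /wt /lincomb; ring. Qed.

Lemma ext_linear f c alpha beta : dual MH0 mh_norm f -> MH alpha -> MH beta ->
  ext f (lincomb c alpha beta) = c * ext f alpha + ext f beta.
Proof.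
move=> fd ha hb; apply: ext_eq => //; first exact: MH_lincomb.
rewrite (_ : (fun k => _) = (fun k => c * f (wt (damp k) alpha) + f (wt (damp k) beta))).
  by apply: tends_lincomb; exact: ext_tends.
by apply: funext => k; rewrite wt_lincomb fd.1 //; exact: MH0_damp.
Qed.

Lemma ext_lincomb f g c alpha : dual MH0 mh_norm f -> dual MH0 mh_norm g -> MH alpha ->
  ext (lincomb c f g) alpha = c * ext f alpha + ext g alpha.
Proof.
move=> fd gd ha; apply: ext_eq => //; first exact: (dual_lincomb MH0_normed).
by apply: tends_lincomb; exact: ext_tends.
Qed.

Lemma ext_bound f alpha : dual MH0 mh_norm f -> MH alpha ->
  cabs (ext f alpha) <= dual_norm MH0 mh_norm f * mh_norm alpha.
Proof.
move=> fd ha; apply: (tends_le (ext_tends fd ha)) => k.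
rewrite (le_trans (dual_normP MH0_normed fd (MH0_damp k ha))) //.
by rewrite ler_wpM2l ?mh_norm_damp // (dual_norm_ge0 MH0_normed).
Qed.

Lemma ext_MH0 f alpha : dual MH0 mh_norm f -> MH0 alpha -> ext f alpha = f alpha.
Proof.
move=> fd ha; apply: ext_eq => //; first exact: ha.1.
move=> e e0; have A0 := mh_norm_ge0 ha.1.2.
have p : 0 < mh_norm alpha + 1 by rewrite ltr_wpDl.
have [K hK] := functional_damp fd (divr_gt0 e0 p).
exists K => k hk; rewrite cabsB (le_trans (hK _ hk _ ha)) //.
by rewrite mulrAC ler_pdivrMr // ler_wpM2l ?(ltW e0) // lerDl.
Qed.

Lemma ext_dual f : dual MH0 mh_norm f -> dual MH mh_norm (ext f).
Proof.
move=> fd; split; first by move=> *; exact: ext_linear.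
split; last by move=> x; exact: restr_out.
by exists (dual_norm MH0 mh_norm f) => x; exact: ext_bound.
Qed.

(** * The bidual *)

Definition coord (n : nat) : (nat -> C) -> C := restr MH0 (fun alpha => alpha n).

Lemma coord_dual n : dual MH0 mh_norm (coord n).
Proof.
apply: (dual_restr MH0_normed (K := 1)) => // alpha ha.
by rewrite mul1r mh_norm_coord //; exact: ha.1.
Qed.

Lemma coord0 : coord 0 = (fun=> 0).
Proof.
apply: funext => x; have [h|h] := pselect (MH0 x); last exact: restr_out.
by rewrite /coord restr_in // h.1.1.
Qed.

Definition bidual_map (Phi : ((nat -> C) -> C) -> C) : nat -> C := fun n => Phi (coord n).

Lemma MH0_dual_normed : normed MH0_dual MH0_dual_norm.
Proof. exact: (dual_normed MH0_normed). Qed.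

(** By linearity the form of [bidual_map Phi] at [a], [b] is [Phi] of the functional sending a
    symbol to its form at [a], [b], whose norm is at most the product of the vector norms. *)
Lemma bidual_map_bounded Phi : MH0_bidual Phi ->
  bounded_by (MH0_bidual_norm Phi) (bidual_map Phi).
Proof.
move=> Pd N a b.
(* [lsum] counts from 0 and vectors from 1, hence the successors. *)
pose h i := lsum N (fun j => b j.+1) (fun j => coord (i.+1 * j.+1)).
pose g := lsum N (fun i => a i.+1) h.
have hd i : MH0_dual (h i) by apply: (lsum_in MH0_dual_normed) => j _; exact: coord_dual.
have gd : MH0_dual g by apply: (lsum_in MH0_dual_normed) => i _; exact: hd.
have bformE alpha : bform N alpha a b =
    \sum_(i < N) a i.+1 * \sum_(j < N) b j.+1 * alpha (i.+1 * j.+1)%N.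
  rewrite /bform big_add1 big_mkord; apply: eq_bigr => i _ /=.
  by rewrite big_add1 big_mkord mulr_sumr; apply: eq_bigr => j _; rewrite mulrA.
have -> : bform N (bidual_map Phi) a b = Phi g.
  rewrite bformE (dual_lsum MH0_dual_normed _ Pd) //; apply: eq_bigr => i _.
  by rewrite (dual_lsum MH0_dual_normed _ Pd) // => j _; exact: coord_dual.
rewrite (le_trans (dual_normP MH0_dual_normed Pd gd)) // -mulrA ler_wpM2l //.
  exact: (dual_norm_ge0 MH0_dual_normed).
apply: (dual_norm_le MH0_normed); first by rewrite mulr_ge0 ?l2norm_ge0.
move=> x hx; rewrite mulrC mulrA.
suff -> : g x = bform N x a b by apply: mh_norm_bound; exact: hx.1.2.
rewrite bformE /g /lsum; apply: eq_bigr => i _; congr (_ * _).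
by apply: eq_bigr => j _; rewrite /coord restr_in.
Qed.

Lemma bidual_map_MH Phi : MH0_bidual Phi -> MH (bidual_map Phi).
Proof.
move=> Pd; split; first by rewrite /bidual_map coord0 (dual0 MH0_dual_normed Pd).
by apply/mh_boundedP; eexists; exact: bidual_map_bounded.
Qed.

Lemma bidual_map_norm_le Phi : MH0_bidual Phi ->
  mh_norm (bidual_map Phi) <= MH0_bidual_norm Phi.
Proof.
move=> Pd; apply: mh_norm_le; first exact: (dual_norm_ge0 MH0_dual_normed).
exact: bidual_map_bounded.
Qed.

Lemma wt_finite t M x : x 0%N = 0 -> (forall n, (M < n)%N -> t n = 0) ->
  wt t x = lsum M (fun j => (t j.+1)%:C * x j.+1) (fun j => delta j.+1).
Proof.
move=> x0 ht; apply: funext => -[|n]; rewrite /wt /lsum.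
  by rewrite x0 mulr0 big1 // => j _; rewrite /delta mulr0.
have [hn|hn] := ltnP n M; last first.
  rewrite ht // mul0r big1 // => j _; rewrite /delta eqSS.
  by case: eqP => [E|_]; rewrite ?mulr0 // ht ?mul0r // -E.
rewrite (bigD1 (Ordinal hn)) //= big1 ?addr0 /delta ?eqxx ?mulr1 // => j hj.
by rewrite eqSS; case: eqP => [E|_]; rewrite ?mulr0 //; rewrite -val_eqE /= E eqxx in hj.
Qed.

Lemma eq_of_small (x y : C) (c : R) : (forall e : R, 0 < e -> cabs (x - y) <= c * e) -> x = y.
Proof.
move=> h; apply/eqP; rewrite -subr_eq0; apply/eqP/cabs_eq0/le_anti.
rewrite cabs_ge0 andbT; apply/ler_addgt0Pr => e e0; rewrite add0r.
have c1 : 0 < `|c| + 1 by rewrite ltr_wpDl.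
rewrite (le_trans (h _ (divr_gt0 e0 c1))) // mulrA ler_pdivrMr // mulrC ler_wpM2l ?(ltW e0) //.
by rewrite (le_trans (ler_norm c)) // lerDl.
Qed.

Lemma damp_dual f k : MH0_dual f -> MH0_dual (restr MH0 (fun x => f (wt (damp k) x))).
Proof.
move=> fd; have nM := MH0_normed; apply: (dual_restr nM (K := MH0_dual_norm f)).
  move=> c x y hx hy; rewrite wt_lincomb fd.1 //; apply: MH0_damp; first exact: hx.1.
  exact: hy.1.
move=> x hx; rewrite (le_trans (dual_normP nM fd (MH0_damp k hx.1))) //.
by rewrite ler_wpM2l ?mh_norm_damp ?(dual_norm_ge0 nM fd) //; exact: hx.1.
Qed.

(** For a finitely supported multiplier [t] in place of [damp k] both sides are the same finite
    combination of coordinates. By [damp_finite_rank] such a [t] approximates [damp k] uniformly on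
    the unit ball, which controls the error on both sides. *)
Lemma bidual_damp Phi f k : MH0_bidual Phi -> MH0_dual f ->
  Phi (restr MH0 (fun x => f (wt (damp k) x))) = f (wt (damp k) (bidual_map Phi)).
Proof.
move=> Pd fd; have nM := MH0_normed; have nD := MH0_dual_normed.
set fk := restr _ _; set al := bidual_map Phi; have mal : MH al := bidual_map_MH Pd.
have F0 : 0 <= MH0_dual_norm f := dual_norm_ge0 nM fd.
have P0 : 0 <= MH0_bidual_norm Phi := dual_norm_ge0 nD Pd.
have fkd : MH0_dual fk by exact: damp_dual.
apply: (@eq_of_small _ _ (MH0_dual_norm f * (MH0_bidual_norm Phi + mh_norm al))) => e e0.
have [t [M [tM ht]]] := damp_finite_rank k e0.
have tE x : MH x -> wt t x = lsum M (fun j => (t j.+1)%:C * x j.+1) (fun j => delta j.+1).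
  by move=> hx; apply: wt_finite => //; exact: hx.1.
have tm x : MH x -> MH0 (wt t x).
  by move=> hx; rewrite tE //; apply: (lsum_in nM) => j _; exact: MH0_delta.
have close x : MH x -> cabs (f (wt (damp k) x) - f (wt t x)) <= MH0_dual_norm f * (e * mh_norm x).
  move=> hx; rewrite -(dualB fd (MH0_damp k hx) (tm _ hx)).
  have E : lincomb (-1) (wt t x) (wt (damp k) x) = wt (fun n => damp k n - t n) x.
    by apply: funext => n; rewrite /wt /lincomb rmorphB; ring.
  have m : MH0 (lincomb (-1) (wt t x) (wt (damp k) x)).
    by apply: (normedL nM); [exact: tm|exact: MH0_damp].
  rewrite (le_trans (dual_normP nM fd m)) // ler_wpM2l // E mh_norm_le //.
    by rewrite mulr_ge0 ?(ltW e0) ?mh_norm_ge0 //; exact: hx.2.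
  by apply: ht; [exact: mh_norm_ge0 hx.2|exact: mh_norm_bound hx.2].
(* This is [f] composed with multiplication by [t], written in coordinates so that [Phi] can be
   evaluated on it. *)
pose ft := lsum M (fun j => (t j.+1)%:C * f (delta j.+1)) (fun j => coord j.+1).
have ftd : MH0_dual ft by apply: (lsum_in nD) => j _; exact: coord_dual.
have Pft : Phi ft = f (wt t al).
  rewrite tE // (dual_lsum nM _ fd); last by move=> j _; exact: MH0_delta.
  rewrite (dual_lsum nD _ Pd); last by move=> j _; exact: coord_dual.
  by apply: eq_bigr => j _; rewrite /al /bidual_map mulrAC.
have ftE x : MH0 x -> ft x = f (wt t x).
  move=> hx; rewrite tE ?(dual_lsum nM _ fd); last 2 first.
  - by move=> j _; exact: MH0_delta.
  - exact: hx.1.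
  by apply: eq_bigr => j _; rewrite /coord restr_in // mulrAC.
have h1 : cabs (Phi fk - Phi ft) <= MH0_bidual_norm Phi * (MH0_dual_norm f * e).
  rewrite -(dualB Pd) //.
  rewrite (le_trans (dual_normP nD Pd (normedL nD _ ftd fkd))) // ler_wpM2l //.
  apply: (dual_norm_le nM); first by rewrite mulr_ge0 ?(ltW e0).
  move=> x hx; rewrite /lincomb mulN1r addrC ftE // /fk restr_in // -mulrA.
  by apply: close; exact: hx.1.
have h2 := close _ mal; rewrite -Pft in h2.
have := cabsD (Phi fk - Phi ft) (Phi ft - f (wt (damp k) al)).
rewrite addrA subrK (cabsB (Phi ft)); lra.
Qed.

(** By [functional_damp] the damped functionals converge to [f] in norm, so their values under [Phi]
    converge to [Phi f]; [bidual_damp] identifies these values with the sequence defining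
    [ext f]. *)
Lemma bidual_ext Phi f : MH0_bidual Phi -> MH0_dual f -> Phi f = ext f (bidual_map Phi).
Proof.
move=> Pd fd; have nM := MH0_normed; have nD := MH0_dual_normed.
apply/esym/ext_eq; [by []|exact: bidual_map_MH|move=> e e0].
have P0 : 0 <= MH0_bidual_norm Phi := dual_norm_ge0 nD Pd.
have p : 0 < MH0_bidual_norm Phi + 1 by rewrite ltr_wpDl.
have [K hK] := functional_damp fd (divr_gt0 e0 p); exists K => k hk.
rewrite -bidual_damp //; set fk := restr _ _.
have fkd : MH0_dual fk by exact: damp_dual.
rewrite -(dualB Pd) // (le_trans (dual_normP nD Pd (normedL nD _ fd fkd))) //.
rewrite (@le_trans _ _ (MH0_bidual_norm Phi * (e / (MH0_bidual_norm Phi + 1)))) //.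
  rewrite ler_wpM2l //; apply: (dual_norm_le nM); first by rewrite divr_ge0 ?(ltW e0) ?(ltW p).
  by move=> x hx; rewrite /lincomb mulN1r addrC /fk restr_in // cabsB hK.
by rewrite mulrA ler_pdivrMr // mulrC ler_wpM2l ?(ltW e0) // lerDl.
Qed.

Definition bidual_inv (alpha : nat -> C) : ((nat -> C) -> C) -> C :=
  restr MH0_dual (fun f => ext f alpha).

Lemma bidual_inv_dual alpha : MH alpha -> MH0_bidual (bidual_inv alpha).
Proof.
move=> ha; apply: (dual_restr MH0_dual_normed (K := mh_norm alpha)).
  by move=> c f g fd gd; exact: ext_lincomb.
by move=> f fd; rewrite mulrC; exact: ext_bound.
Qed.

Lemma ext_coord n alpha : MH alpha -> ext (coord n) alpha = alpha n.
Proof.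
move=> ha; apply: ext_eq => //; first exact: coord_dual.
move=> e e0; have A0 := mh_norm_ge0 ha.2.
have p : 0 < mh_norm alpha + 1 by rewrite ltr_wpDl.
have [K hK] := damp_to1 n (divr_gt0 e0 p); exists K => k hk.
rewrite /coord restr_in; last exact: MH0_damp.
have -> : wt (damp k) alpha n - alpha n = (damp k n - 1)%:C * alpha n.
  by rewrite /wt rmorphB mulrBl mul1r.
rewrite cabsM cabs_real distrC.
rewrite (le_trans (ler_pM _ _ (hK _ hk n (leqnn _)) (mh_norm_coord n ha))) ?cabs_ge0 //.
by rewrite mulrAC ler_pdivrMr // ler_wpM2l ?(ltW e0) // lerDl.
Qed.

Lemma bidual_invK alpha : MH alpha -> bidual_map (bidual_inv alpha) = alpha.
Proof.
move=> ha; apply: funext => n; rewrite /bidual_map /bidual_inv restr_in ?ext_coord //.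
exact: coord_dual.
Qed.

Lemma bidual_mapK Phi : MH0_bidual Phi -> bidual_inv (bidual_map Phi) = Phi.
Proof.
move=> Pd; have h := bidual_inv_dual (bidual_map_MH Pd).
apply: (dual_ext h Pd) => f fd; by rewrite /bidual_inv restr_in // -bidual_ext.
Qed.

(** The inequality opposite to [bidual_map_norm_le] holds because [ext f] is bounded by the norm of
    [f]. *)
Lemma bidual_map_norm Phi : MH0_bidual Phi -> mh_norm (bidual_map Phi) = MH0_bidual_norm Phi.
Proof.
move=> Pd; have ha := bidual_map_MH Pd.
apply/le_anti; rewrite bidual_map_norm_le //=; apply: (dual_norm_le MH0_dual_normed).
  exact: mh_norm_ge0 ha.2.
by move=> f fd; rewrite (bidual_ext Pd fd) mulrC; exact: ext_bound.
Qed.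

Lemma bidual_map_canon m : MH0 m -> bidual_map (Defs.canon MH0 mh_norm m) = m.
Proof.
move=> hm; apply: funext => n; rewrite /bidual_map /Defs.canon asboolT; last exact: coord_dual.
by rewrite /coord restr_in.
Qed.

Lemma bidual_map_iso : is_isometric_iso_ext bidual_map.
Proof.
split; first by [].
split; first exact: bidual_map_MH.
split; first by move=> P Q Pd Qd E; rewrite -(bidual_mapK Pd) -(bidual_mapK Qd) E.
split.
  move=> al ha; exists (bidual_inv al); split; first exact: bidual_inv_dual.
  exact: bidual_invK.
by split; [exact: bidual_map_norm|exact: bidual_map_canon].
Qed.

Lemma bidual_inv_canon m : MH0 m -> bidual_inv m = Defs.canon MH0 mh_norm m.
Proof.
move=> hm; apply: funext => f; rewrite /bidual_inv /restr /Defs.canon.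
by case: asboolP => // fd; rewrite ext_MH0.
Qed.

(** * The M-ideal property *)

(** Up to a small error the damped vector has finitely many coordinates, and against those
    [row_tail] applies. *)
Lemma damp_row_tail k beta (e : R) : mh_bounded beta -> bounded_by 1 beta -> 0 < e ->
  exists M, forall N a b,
    cabs (bform N beta (hi M a) (wt (damp k) b)) <= e * l2norm N a * l2norm N b.
Proof.
move=> hb b1 e0; have e2 : 0 < e / 2 by rewrite divr_gt0.
have [L hL] := damp_to0 k e2; have [M hM] := row_tail L hb e2.
exists M => N a b; rewrite (bform_lo_hi_r _ _ L) (le_trans (cabsD _ _)) //.
rewrite [e]splitr !mulrDl lerD //.
  rewrite (le_trans (hM _ _ _)) // ler_wpM2l ?l2norm_damp //.
  by rewrite mulr_ge0 ?l2norm_ge0 ?(ltW e2).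
have h : l2norm N (hi L (wt (damp k) b)) <= e / 2 * l2norm N b.
  rewrite /hi wt_wt; apply: l2norm_wt; first exact: ltW.
  move=> n _; case: ltnP => hn; rewrite ?mul1r ?mul0r ?normr0 ?(ltW e2) //.
  by rewrite ger0_norm ?damp_ge0 ?hL.
rewrite (le_trans (bform_le_of ler01 b1 (l2norm_hi N M a) h)) // mul1r mulrCA mulrA.
by rewrite lexx.
Qed.

(** Supplies the gliding hump for a cross term: [1 - D] suppresses the coordinates up to [M], and
    the damping of the other variable suppresses those beyond [M']. *)
Lemma cross_block k beta (e : R) M : mh_bounded beta -> bounded_by 1 beta -> 0 < e ->
  (forall n, (n <= M)%N -> `|1 - damp k n| <= e / 4) ->
  exists2 M', (M <= M')%N & forall N a b,
    cabs (bform N beta (wt (codamp k) a) (wt (damp k) b)) <=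
    l2norm N (mid M M' a) * l2norm N b + e / 2 * (l2norm N a * l2norm N b).
Proof.
move=> hb b1 e0 hd; have e4 : 0 < e / 4 by rewrite divr_gt0.
have [M0 hM0] := damp_row_tail k hb b1 e4; pose M' := maxn M M0.
have MM' : (M <= M')%N by exact: leq_maxl.
exists M' => // N a b; set b' := wt (damp k) b; set a' := wt (codamp k) a.
have lb : l2norm N b' <= l2norm N b by exact: l2norm_damp.
have la : l2norm N a' <= l2norm N a by exact: l2norm_codamp.
have spl n : (1 <= n <= N)%N -> (n <= M')%:R = (n <= M)%:R + (M < n <= M')%:R :> R.
  by move=> _; exact: lo_splitE.
rewrite (bform_lo_hi_l _ _ M') (bform_wtDl _ _ _ spl).
have B0 := l2norm_ge0 N b.
have k1 : cabs (bform N beta (lo M a') b') <= e / 4 * (l2norm N a * l2norm N b).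
  have h : l2norm N (lo M a') <= e / 4 * l2norm N a.
    by rewrite /a' /lo wt_comm; apply: l2norm_codamp_lo => //; exact: ltW.
  by rewrite (le_trans (bform_le_of ler01 b1 h lb)) // mul1r mulrA.
have k2 : cabs (bform N beta (mid M M' a') b') <= l2norm N (mid M M' a) * l2norm N b.
  have h : l2norm N (mid M M' a') <= l2norm N (mid M M' a).
    by rewrite /a' /mid wt_comm l2norm_codamp.
  by rewrite (le_trans (bform_le_of ler01 b1 h lb)) // mul1r.
have k3 : cabs (bform N beta (hi M' a') b') <= e / 4 * (l2norm N a * l2norm N b).
  rewrite -(hi_hi _ (leq_maxr M M0)) (le_trans (hM0 _ _ _)) // -mulrA ler_wpM2l ?(ltW e4) //.
  by rewrite ler_wpM2r // (le_trans (l2norm_hi _ _ _)).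
move: k1 k2 k3; rewrite -/(lo M a') -/(mid M M' a').
set x1 := bform _ _ _ _; set x2 := bform _ _ _ _; set x3 := bform _ _ _ _.
have := cabsD x1 x2; have := cabsD (x1 + x2) x3; lra.
Qed.

Lemma tail_small_block alpha (e : R) : tail_small alpha -> 0 < e ->
  exists M, forall N a b, cabs (bform N alpha a b) <=
    cabs (bform N alpha (lo M a) (lo M b)) + e * (l2norm N a * l2norm N b).
Proof.
move=> ht e0; have e2 : 0 < e / 2 by rewrite divr_gt0.
have [M hM] := ht _ e2; exists M => N a b.
rewrite (bform_lo_hi_l _ _ M) (bform_lo_hi_r _ _ M (lo M a)).
have k1 := hM N a b.
have k2 : cabs (bform N alpha (lo M a) (hi M b)) <= e / 2 * (l2norm N a * l2norm N b).
  rewrite bform_sym (le_trans (hM _ _ _)) // -mulrA ler_wpM2l ?(ltW e2) // mulrC.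
  by rewrite ler_wpM2r ?l2norm_ge0 // l2norm_lo.
move: k1 k2; set x1 := bform _ _ _ b; set x2 := bform _ _ _ (hi M b).
set x3 := bform _ _ _ (lo M b).
have := cabsD x3 x2; have := cabsD (x3 + x2) x1; lra.
Qed.

(* [beta - avg D beta D] is the average of the diagonal parts [(1 - D) beta (1 - D)], which
   nearly live on the complement of the block carrying [alpha], and of cross terms, which
   have small norm by the gliding hump. *)
Lemma averaged_norm alpha beta (e : R) K0 : MH0 alpha -> bounded_by 1 alpha ->
  MH beta -> bounded_by 1 beta -> 0 < e ->
  exists J (s : nat -> nat), [/\ (0 < J)%N, forall j, (j < J)%N -> (K0 <= s j)%N &
    bounded_by (1 + e) (lincomb 1 alpha
      (lincomb (-1) (lsum J (fun=> J%:R^-1) (fun j => wt (damp (s j)) beta)) beta))].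
Proof.
move=> /MH0P[_ ta] a1 hb b1 e0; have e4 : 0 < e / 4 by rewrite divr_gt0.
have [M hM] := tail_small_block ta e4.
(* The square root appears because [(1 - damp) ^ 2] has to be at most [e / 4] on the corner carrying
   [alpha]. *)
have [|K1 hK1] := @damp_to1 M (Num.sqrt (e / 4)); first by rewrite sqrtr_gt0.
pose G k N a b := cabs (bform N beta (wt (codamp k) a) (wt (damp k) b)) +
                  cabs (bform N beta (wt (codamp k) b) (wt (damp k) a)).
have hG L : exists k L', [/\ (maxn K0 K1 <= k)%N, (L <= L')%N & forall N a b, G k N a b <=
     1 * (l2norm N (mid L L' a) * l2norm N b + l2norm N a * l2norm N (mid L L' b))
     + e / 4 * (l2norm N a * l2norm N b)].
  (* [cross_block] is applied with tolerance [e / 4], so each of the two cross terms has error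
     [e / 8]. *)
  have [|K2 hK2] := @damp_to1 L (e / 4 / 4); first by rewrite !divr_gt0.
  have [L' LL' h] := cross_block hb.2 b1 e4 (hK2 _ (leq_maxr (maxn K0 K1) K2)).
  exists (maxn (maxn K0 K1) K2), L'; split; rewrite ?leq_maxl // => N a b.
  have := h N a b; have := h N b a; rewrite /G; lra.
(* With [m * e >= 8] the hump term [2 * m] is at most [m * m * e / 4]. *)
pose m := (Num.bound (8 / e)).+1.
have hm : 8 / e < m%:R by rewrite (lt_trans (archi_boundP _)) ?ltr_nat // divr_ge0 ?ltW.
have m0 : 0 < m%:R :> R by rewrite ltr0n.
have [s [Qs hs]] := gliding_hump ler01 hG (m * m) 0.
pose J := (m * m)%N; have J0 : (0 < J)%N by rewrite muln_gt0.
have J0' : 0 < J%:R :> R by rewrite ltr0n.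
exists J, s; split => // [j /Qs|N a b]; first by rewrite geq_max => /andP[].
set gam := lincomb (-1) _ _.
set A := l2norm N a; set B := l2norm N b.
have A0 : 0 <= A by exact: l2norm_ge0.
have B0 : 0 <= B by exact: l2norm_ge0.
pose ga j := bform N (lincomb (-1) (wt (damp (s j)) beta) beta) a b.
have gamE : bform N gam a b = J%:R^-1 * \sum_(j < J) ga j.
  have -> : gam = lsum J (fun=> J%:R^-1) (fun j => lincomb (-1) (wt (damp (s j)) beta) beta).
    apply: funext => n; rewrite /gam /lincomb /lsum -!mulr_sumr big_split /= sumr_const card_ord.
    by rewrite -mulr_sumr -[beta n *+ J]mulr_natl; field; rewrite pnatr_eq0 -lt0n.
  rewrite /ga /bform [in RHS]exchange_big /= mulr_sumr; apply: eq_bigr => n _.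
  rewrite [in RHS]exchange_big /= mulr_sumr; apply: eq_bigr => l _.
  by rewrite /lsum -!mulr_sumr; ring.
have q2 : Num.sqrt (1 + e / 4) ^+ 2 = 1 + e / 4.
  by rewrite sqr_sqrtr // addr_ge0 // ltW.
have gaj j : (j < J)%N -> cabs (bform N alpha (lo M a) (lo M b)) + cabs (ga j) <=
    (1 + e / 4) * (A * B) + G (s j) N a b.
  move=> hj; have /andP[_ hK] : (K0 <= s j)%N && (K1 <= s j)%N by rewrite -geq_max Qs.
  (* Up to [M] the two squared weights add up to at most [1 + e / 4]; beyond [M] only [codamp] is
     present. So the corner of [alpha] and the diagonal part of [beta] act on nearly orthogonal
     pieces. *)
  have cs x : l2norm N (lo M x) ^+ 2 + l2norm N (wt (codamp (s j)) x) ^+ 2 <=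
      (Num.sqrt (1 + e / 4) * l2norm N x) ^+ 2.
    rewrite exprMn q2; apply: sqr_l2norm_wt_le => n _; case: leqP => hn.
      rewrite expr1n lerD2l -[leRHS]sqr_sqrtr ?(ltW e4) //.
      rewrite -[leLHS]real_normK ?num_real // ler_pXn2r ?nnegrE ?sqrtr_ge0 //.
      exact: hK1.
    rewrite expr0n add0r -[leLHS]real_normK ?num_real //.
    have h1 : `|codamp (s j) n| ^+ 2 <= 1 by rewrite exprn_ile1 ?codamp_norm.
    by rewrite (le_trans h1) // lerDl ltW.
  have sA : 0 <= Num.sqrt (1 + e / 4) * A by rewrite mulr_ge0 ?sqrtr_ge0.
  have sB : 0 <= Num.sqrt (1 + e / 4) * B by rewrite mulr_ge0 ?sqrtr_ge0.
  have := cauchy_schwarz2 sA sB (cs a) (cs b).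
  rewrite mulrACA -expr2 q2.
  have := a1 N (lo M a) (lo M b); have := b1 N (wt (codamp (s j)) a) (wt (codamp (s j)) b).
  rewrite !mul1r /ga bform_codamp.
  have hd n : (1 <= n <= N)%N -> (fun=> 1 : R) n = codamp (s j) n + damp (s j) n.
    by move=> _; rewrite /codamp subrK.
  rewrite -[in bform N beta (wt (codamp (s j)) a) b](wt1 b) (bform_wtDr _ _ _ hd) /G.
  rewrite (bform_sym _ _ (wt (damp (s j)) a)).
  set x1 := bform _ beta _ _; set x2 := bform _ beta _ _; set x3 := bform _ beta _ _.
  have := cabsD x1 x2; have := cabsD (x1 + x2) x3; lra.
have sumG : \sum_(j < J) G (s j) N a b <= J%:R * (e / 2 * (A * B)).
  rewrite (le_trans (hs _ _ _)) // mul1r /J natrM -expr2 sqrtr_sqr ger0_norm ?(ltW m0) //.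
  have ha := ler_wpM2r B0 (l2norm_hi N 0 a); have hb' := ler_wpM2l A0 (l2norm_hi N 0 b).
  have h1 := ler_wpM2l (ltW m0) (lerD ha hb').
  apply: (le_trans (lerD h1 (lexx _))); rewrite -/A -/B.
  have h2 : 8 <= m%:R * e by rewrite ltW // -ltr_pdivrMr.
  have h3 := ler_wpM2l (mulr_ge0 (ltW m0) (mulr_ge0 A0 B0)) h2.
  rewrite expr2; lra.
(* The diagonal parts give [1 + e / 4] and the averaged cross terms [e / 2]; the last [e / 4] is
   lost when [alpha] is cut to its corner. *)
have total : cabs (bform N alpha (lo M a) (lo M b)) + cabs (bform N gam a b) <=
    (1 + 3 * e / 4) * (A * B).
  rewrite gamE cabsM cabs_natV -(ler_pM2l J0') mulrDr mulVKf ?gt_eqF //.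
  rewrite (@le_trans _ _ (\sum_(j < J) (cabs (bform N alpha (lo M a) (lo M b)) + cabs (ga j)))) //.
    rewrite big_split /= sumr_const card_ord -[X in _ <= X + _]mulr_natl lerD2l; exact: cabs_sum.
  rewrite (@le_trans _ _ (\sum_(j < J) ((1 + e / 4) * (A * B) + G (s j) N a b))) //.
    by apply: ler_sum => j _; exact: gaj.
  rewrite big_split /= sumr_const card_ord -[X in X + _ <= _]mulr_natl.
  have := sumG; lra.
rewrite bform_lincomb mul1r (le_trans (cabsD _ _)) //.
have := hM N a b; rewrite -/A -/B; have := total; lra.
Qed.

Lemma le_of_small (x y c : R) : 0 <= c -> (forall e, 0 < e -> x <= y + c * e) -> x <= y.
Proof.
move=> c0 h; apply/ler_addgt0Pr => e e0.
have c1 : 0 < c + 1 by rewrite ltr_wpDl.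
rewrite (le_trans (h _ (divr_gt0 e0 c1))) // lerD2l mulrA ler_pdivrMr // mulrC.
by rewrite ler_wpM2l ?(ltW e0) // lerDl.
Qed.

Lemma restr_dual f : dual MH mh_norm f -> dual MH0 mh_norm (restr MH0 f).
Proof.
move=> fd; apply: (dual_restr MH0_normed (K := dual_norm MH mh_norm f)).
  by move=> c x y hx hy; apply: fd.1; [exact: hx.1|exact: hy.1].
by move=> x hx; apply: (dual_normP MH_normed) => //; exact: hx.1.
Qed.

Definition lproj (f : (nat -> C) -> C) : (nat -> C) -> C :=
  lincomb (-1) (ext (restr MH0 f)) f.

Lemma lproj_dual f : dual MH mh_norm f -> dual MH mh_norm (lproj f).
Proof.
by move=> fd; apply: (dual_lincomb MH_normed) => //; apply: ext_dual; exact: restr_dual.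
Qed.

Lemma lproj_compl f : lincomb (-1) (lproj f) f = ext (restr MH0 f).
Proof. by apply: funext => x; rewrite /lproj /lincomb; ring. Qed.

(** Apply [f] to the symbol of norm at most [1 + e] given by [averaged_norm], with phases rotated.
    The compact part yields [ext (restr MH0 f) al], and subtracting the averaged dampings leaves
    [lproj f be], both up to [e]. *)
Lemma lproj_separation f al be (e : R) : dual MH mh_norm f -> MH al -> mh_norm al <= 1 ->
  MH be -> mh_norm be <= 1 -> 0 < e ->
  cabs (lproj f be) + cabs (ext (restr MH0 f) al) <=
  dual_norm MH mh_norm f + (dual_norm MH mh_norm f + 2) * e.
Proof.
move=> fd mal al1 mbe be1 e0; have nM := MH_normed; have nM0 := MH0_normed.
set g := restr MH0 f; have gd : dual MH0 mh_norm g := restr_dual fd.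
set F := dual_norm MH mh_norm f.
(* [al] is only bounded, so it is replaced by a compact damping [a0] on which [g] nearly attains
   [ext g al]. *)
have [K /(_ K (leqnn _)) hK] := ext_tends gd mal e0.
set a0 := wt (damp K) al in hK; have ma0 : MH0 a0 by exact: MH0_damp.
have [c c1 cE] := cabs_phase (g a0); have [d d1 dE] := cabs_phase (lproj f be).
pose a1 := lincomb c a0 (fun=> 0); pose b1 := lincomb d be (fun=> 0).
have ma1 : MH0 a1 by exact: (normedZ nM0).
have mb1 : MH b1 by exact: (normedZ nM).
have bnd x : MH x -> mh_norm x <= 1 -> bounded_by 1 x.
  move=> hx x1 N a b; rewrite (le_trans (mh_norm_bound hx.2 _ _ _)) //.
  by rewrite !ler_wpM2r ?l2norm_ge0.
have bd1 : bounded_by 1 a1.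
  apply: bnd; first exact: ma1.1.
  rewrite (le_trans (nrmZ nM0 _ ma0)) // c1 mul1r (le_trans _ al1) //; exact: mh_norm_damp.
have bd2 : bounded_by 1 b1.
  by apply: bnd => //; rewrite (le_trans (nrmZ nM _ mbe)) // d1 mul1r.
(* From [K0] on every damping of [b1] has [g]-value within [e] of [ext g b1], and therefore so does
   any average of them. *)
have [K0 hK0] := ext_tends gd mb1 e0.
have [J [s [J0 hs hb]]] := averaged_norm K0 ma1 bd1 mb1 bd2 e0.
set av := lsum J _ _ in hb; set gam := lincomb 1 _ _ in hb.
have ms j : MH (wt (damp (s j)) b1) by exact: MH_damp.
have mav : MH av by apply: (lsum_in nM) => j _; exact: ms.
have mga : MH gam by apply: (normedL nM); [exact: ma1.1|exact: (normedL nM)].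
have J0' : J%:R != 0 :> C by rewrite pnatr_eq0 -lt0n.
have fga : f gam = (cabs (g a0))%:C + (cabs (lproj f be))%:C + (ext g b1 - f av).
  rewrite /gam fd.1; [|exact: ma1.1|exact: (normedL nM)].
  rewrite (dualB fd) // mul1r -dE -cE.
  have -> : f a1 = c * g a0 by rewrite (dualZ nM) //; [rewrite /g restr_in|exact: ma0.1].
  have -> : d * lproj f be = f b1 - ext g b1.
    rewrite -(dualZ nM _ (lproj_dual fd)) // -/b1 /lproj /lincomb -/g; ring.
  by ring.
have fav : cabs (ext g b1 - f av) <= e.
  have -> : ext g b1 - f av = \sum_(j < J) J%:R^-1 * (ext g b1 - f (wt (damp (s j)) b1)).
    rewrite (dual_lsum nM _ fd) // -!mulr_sumr sumrB sumr_const card_ord.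
    by rewrite -[_ *+ J]mulr_natl; field.
  rewrite (le_trans (cabs_sum _ _ _)) //.
  rewrite (@le_trans _ _ (\sum_(j < J) J%:R^-1 * e)) //.
    apply: ler_sum => j _; rewrite cabsM cabs_natV ler_wpM2l ?invr_ge0 //.
    rewrite cabsB; have := hK0 (s j) (hs j (ltn_ord j)).
    by rewrite /g restr_in //; exact: MH0_damp.
  by rewrite sumr_const card_ord -[leLHS]mulr_natl mulVKf // pnatr_eq0 -lt0n.
(* The errors are [F * e] here, [e] from the average and [e] from replacing [al], which gives the
   factor [F + 2]. *)
have fb : cabs (f gam) <= F * (1 + e).
  rewrite (le_trans (dual_normP nM fd mga)) // ler_wpM2l ?(dual_norm_ge0 nM) //.
  by apply: mh_norm_le => //; rewrite addr_ge0 // ltW.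
have t1 := cabsD (f gam) (- (ext g b1 - f av)); rewrite cabsN {1}fga addrK -rmorphD in t1.
rewrite cabs_real ger0_norm ?addr_ge0 ?cabs_ge0 // in t1.
have t2 := cabsD (ext g al - g a0) (g a0); rewrite subrK cabsB in t2.
lra.
Qed.

(** One inequality is the triangle inequality. For the other, the two arguments of
    [lproj_separation] are independent, so the suprema can be taken one after the other. *)
Lemma lproj_norm f : dual MH mh_norm f ->
  dual_norm MH mh_norm f =
  dual_norm MH mh_norm (lproj f) + dual_norm MH mh_norm (ext (restr MH0 f)).
Proof.
move=> fd; have nM := MH_normed; have pd := lproj_dual fd.
have ed := ext_dual (restr_dual fd).
apply/le_anti/andP; split.
  have := nrm_lincomb (dual_normed nM) 1 pd ed; rewrite cabs1 mul1r.
  by rewrite (_ : lincomb 1 _ _ = f) //; apply: funext => x; rewrite /lproj /lincomb; ring.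
have F0 : 0 <= dual_norm MH mh_norm f by exact: (dual_norm_ge0 nM).
rewrite -lerBrDr; apply: (dual_norm_le1 nM) => be mbe be1.
rewrite lerBrDl -lerBrDr; apply: (dual_norm_le1 nM) => al mal al1.
rewrite lerBrDr addrC; apply: (@le_of_small _ _ (dual_norm MH mh_norm f + 2)).
  by rewrite addr_ge0.
by move=> e e0; exact: lproj_separation.
Qed.

Lemma restr_lincomb (X : Type) (S : set (X -> C)) c f g :
  restr S (lincomb c f g) = lincomb c (restr S f) (restr S g).
Proof.
by apply: funext => x; rewrite /restr /lincomb; case: asboolP; rewrite ?mulr0 ?addr0.
Qed.

Lemma MH0_M_ideal : M_ideal MH MH0 mh_norm.
Proof.
exists lproj; split; [|split; [|split]].
- move=> c f g fd gd; have [fd0 gd0] := (restr_dual fd, restr_dual gd).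
  rewrite /lproj restr_lincomb.
  have -> : ext (lincomb c (restr MH0 f) (restr MH0 g)) =
      lincomb c (ext (restr MH0 f)) (ext (restr MH0 g)).
    apply: (@dual_ext _ MH mh_norm).
    + by apply: ext_dual; exact: (dual_lincomb MH0_normed).
    + by apply: (dual_lincomb MH_normed); exact: ext_dual.
    by move=> x hx; rewrite ext_lincomb.
  by apply: funext => x; rewrite /lincomb; ring.
- move=> f fd; split; first exact: lproj_dual.
  move=> z hz; rewrite /lproj /lincomb ext_MH0 //; last exact: restr_dual.
  by rewrite restr_in // mulN1r addNr.
- move=> f [fd f0]; apply: (dual_ext (lproj_dual fd) fd) => x hx.
  (* A functional that annihilates [MH0] vanishes on every damping, so the extension of its
     restriction is 0. *)
  rewrite /lproj /lincomb (@ext_eq _ x 0) ?mulr0 ?add0r //; first exact: restr_dual.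
  move=> e e0; exists 0%N => k _; have hd := MH0_damp k hx.
  by rewrite restr_in // f0 // subrr cabs0 ltW.
- by move=> f fd; rewrite lproj_compl; exact: lproj_norm.
Qed.

(** * Uniqueness of the isometry *)

Lemma bidual_inv_lincomb c al be : MH al -> MH be ->
  bidual_inv (lincomb c al be) = lincomb c (bidual_inv al) (bidual_inv be).
Proof.
move=> ha hb; rewrite /bidual_inv -restr_lincomb.
by apply: funext => f; rewrite /restr; case: asboolP => // fd; rewrite ext_linear.
Qed.

(* Norm-preserving extensions of functionals from [MH0] to [MH] are unique, by the
   L-decomposition; apply this to the coordinates of [U'] transported to [MH]. *)
Lemma isometric_iso_ext_unique U' Phi : is_isometric_iso_ext U' -> MH0_bidual Phi ->
  U' Phi = bidual_map Phi.
Proof.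
move=> [UL [UM [_ [_ [Un Uc]]]]] Pd; apply: funext => n; have nM := MH_normed.
(* The [n]-th coordinate of [U'] as a functional on [MH]; it extends [coord n] because [U'] fixes
   compact symbols. *)
pose w := restr MH (fun al => U' (bidual_inv al) n).
have ed := ext_dual (coord_dual n); pose E := dual_norm MH mh_norm (ext (coord n)).
(* Both [U'] and [bidual_inv] preserve norms, so [w] is no larger than the canonical extension of
   [coord n]. *)
have wb al : MH al -> cabs (U' (bidual_inv al) n) <= E * mh_norm al.
  move=> hal; have id := bidual_inv_dual hal; rewrite -(ext_coord n (UM _ id)).
  by rewrite (le_trans (dual_normP nM ed (UM _ id))) // Un // -bidual_map_norm // bidual_invK.
have wd : dual MH mh_norm w.
  apply: (dual_restr nM (K := E)) => // c x y hx hy.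
  by rewrite bidual_inv_lincomb // UL //; exact: bidual_inv_dual.
have w0 : restr MH0 w = coord n.
  apply: (dual_ext (restr_dual wd) (coord_dual n)) => x hx.
  rewrite /coord !restr_in // /w restr_in; last exact: hx.1.
  by rewrite bidual_inv_canon // Uc.
have wE : dual_norm MH mh_norm w <= E.
  apply: (dual_norm_le nM); first exact: (dual_norm_ge0 nM).
  by move=> x hx; rewrite /w restr_in ?wb.
have := lproj_norm wd; rewrite w0 -/E => hn.
have mb := bidual_map_MH Pd.
(* In the norm decomposition of [w] the extension part already has norm [E], which leaves nothing
   for [lproj w]. *)
have p0 : dual_norm MH mh_norm (lproj w) <= 0 by move: wE; rewrite hn; lra.
have := dual_normP nM (lproj_dual wd) mb.
have := ler_wpM2r (mh_norm_ge0 mb.2) p0; rewrite mul0r => h1 h2.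
have /cabs_eq0 : cabs (lproj w (bidual_map Phi)) = 0.
  by apply/le_anti; rewrite cabs_ge0 (le_trans h2 h1).
rewrite /lproj /lincomb w0 ext_coord // /w restr_in // bidual_mapK // mulN1r addrC.
by move/eqP; rewrite subr_eq0 => /eqP.
Qed.

Theorem theorem2 :
  (exists U, is_isometric_iso_ext U /\
     forall U', is_isometric_iso_ext U' ->
       forall Phi, MH0_bidual Phi -> U' Phi = U Phi)
  /\ M_ideal MH MH0 mh_norm.
Proof.
split; last exact: MH0_M_ideal.
exists bidual_map; split; first exact: bidual_map_iso.
by move=> U' hU Phi; exact: isometric_iso_ext_unique.
Qed.
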